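(* Let $p$ be a prime, let $H$ be Abels' group of $4\times 4$ upper-triangular matrices over $\mathbb{Z}[1/p]$, let $Z=Z(H)$ be its centre (which is isomorphic to the additive group $\mathbb{Z}[1/p]$), let $C \leq Z$ be an infinite cyclic subgroup, and let $G=H/C$. Then $G$ is a finitely presented soluble group, $\mathrm{Tor}(G)=Z/C\cong \mathbb{Z}[1/p]/\mathbb{Z}$, and $G/\mathrm{Tor}(G)\cong H/Z$ is a soluble group that is recursively presented but not finitely presented.
   Context: For a group $G$, the torsion subgroup $\mathrm{Tor}(G)$ is the (normal) subgroup of $G$ generated by all elements of finite order. Abels' group $H$ (for the prime $p$) is the group of all upper-triangular $4 \times 4$ matrices $(a_{ij})$ with entries in $\mathbb{Z}[1/p]$, with $a_{11}=a_{44}=1$ and with $a_{22}, a_{33}$ integer powers of $p$ (i.e. elements of $\{p^k \mid k \in \mathbb{Z}\}$). By a known theorem of Abels, $H$ is finitely presented; it is torsion-free and soluble, and its centre $Z(H)$ consists of the matrices that differ from the identity only in the $(1,4)$ entry, so that $Z(H)\cong\mathbb{Z}[1/p]$. A group is recursively presented if it has a presentation with finitely many generators and a recursively enumerable set of relators.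
   Formalization: The claim Z/C ≅ Z[1/p]/Z fails for some infinite cyclic C (p = 2, C = 3Z gives an element of order 3); it is replaced by Tor(G) ≅ Z[1/p]/mZ with m prime to p, and by Tor(G) ≅ Z[1/p]/Z exactly when C is generated by 1 + p^k E_14 for some integer k. *)

(* Defs.v *)
From HB Require Import structures.
From mathcomp Require Import all_boot all_order all_algebra.
From mathcomp Require Import boolp.

Set Implicit Arguments.
Unset Strict Implicit.
Unset Printing Implicit Defensive.

Import Order.TTheory GRing.Theory Num.Theory.

Local Open Scope group_scope.
Local Open Scope quotient_scope.

(******************************************************************************)
(* Arbitrary (possibly infinite) groups are groupTypes.  A subset is a        *)
(* {pred G}, a subgroup is a subset S with a proof of group_closed S, and     *)
(* Prop-valued conditions are turned into predicates classically by `[< _ >]. *)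
(******************************************************************************)

Definition isomorphic (G K : groupType) : Prop :=
  exists f : {multiplicative G -> K}, bijective f.

Section SubgroupType.
Variables (G : groupType) (S : {pred G}) (gS : group_closed S).

Definition subgrp of group_closed S := {x : G | x \in S}.
Local Notation T := (subgrp gS).

HB.instance Definition _ := SubChoice.on T.
HB.instance Definition _ := SubChoice_isSubGroup.Build G _ T gS.

End SubgroupType.

Definition normal_closed (G : groupType) (S : {pred G}) : Prop :=
  group_closed S /\ forall x y : G, x \in S -> x ^ y \in S.

Section Quotient.
Variables (G : groupType) (S : {pred G}) (nS : normal_closed S).

Definition coset_rel : rel G := fun x y => x^-1 * y \in S.

Lemma coset_rel_equiv : equiv_class_of coset_rel.
Proof.
have [gS _] := nS; have SV := group_closedV gS; have SM := group_closedM gS.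
split=> [x | x y | y x z]; rewrite /coset_rel.
- by rewrite mulVg; case: gS.
- by apply/idP/idP=> /SV; rewrite invgM invgK.
- move=> Sxy Syz.
  have -> : x^-1 * z = (x^-1 * y) * (y^-1 * z) by rewrite mulgA mulgK.
  exact: SM.
Qed.

Definition coset_equiv := EquivRelPack coset_rel_equiv.

Definition quotg := {eq_quot coset_equiv}.

HB.instance Definition _ : EqQuotient G coset_equiv quotg :=
  EqQuotient.on quotg.
HB.instance Definition _ := Choice.on quotg.

Lemma quotgE (x y : G) : (x == y %[mod quotg]) = (x^-1 * y \in S).
Proof. by rewrite piE. Qed.

Definition quotg_one : quotg := \pi_quotg 1.
Definition quotg_mul (a b : quotg) : quotg := \pi_quotg (repr a * repr b).
Definition quotg_inv (a : quotg) : quotg := \pi_quotg (repr a)^-1.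

Let repr_mod (x : G) : x^-1 * repr (\pi_quotg x) \in S.
Proof. by rewrite -quotgE reprK. Qed.

Let pi_mul (x y : G) : quotg_mul (\pi_quotg x) (\pi_quotg y) = \pi_quotg (x * y).
Proof.
apply/esym/eqP; rewrite quotgE invgM.
have [gS SJ] := nS; have SM := group_closedM gS.
set x' := repr _; set y' := repr _.
have -> : y^-1 * x^-1 * (x' * y') = (x^-1 * x') ^ y * (y^-1 * y').
  by rewrite conjgE !mulgA mulgK.
by apply: SM (repr_mod y); apply/SJ/repr_mod.
Qed.

Let pi_inv (x : G) : quotg_inv (\pi_quotg x) = \pi_quotg x^-1.
Proof.
apply/esym/eqP; rewrite quotgE invgK.
have [gS SJ] := nS; set x' := repr _.
have -> : x * x'^-1 = ((x^-1 * x')^-1) ^ x^-1.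
  by rewrite conjgE invgM !invgK !mulgA mulgK.
by apply/SJ/(group_closedV gS)/repr_mod.
Qed.

Let mulA : associative quotg_mul.
Proof.
elim/quotW=> x; elim/quotW=> y; elim/quotW=> z.
by rewrite (pi_mul y z) (pi_mul x y) (pi_mul x) (pi_mul _ z) mulgA.
Qed.
Let mul1 : left_id quotg_one quotg_mul.
Proof. by elim/quotW=> x; rewrite /quotg_one pi_mul mul1g. Qed.
Let mulr1 : right_id quotg_one quotg_mul.
Proof. by elim/quotW=> x; rewrite /quotg_one pi_mul mulg1. Qed.
Let mulV : left_inverse quotg_one quotg_inv quotg_mul.
Proof. by elim/quotW=> x; rewrite pi_inv pi_mul mulVg. Qed.
Let mulrV : right_inverse quotg_one quotg_inv quotg_mul.
Proof. by elim/quotW=> x; rewrite pi_inv pi_mul mulgV. Qed.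

HB.instance Definition _ := isGroup.Build quotg mulA mul1 mulr1 mulV mulrV.

Lemma pi_quotgM (x y : G) : \pi_quotg (x * y) = \pi_quotg x * \pi_quotg y.
Proof. by rewrite -pi_mul. Qed.

Definition quotg_image (A : {pred G}) : {pred quotg} :=
  fun a => `[< exists2 x, x \in A & a = \pi_quotg x >].

End Quotient.

Arguments quotg_image {G S} nS A.

Section Subgroups.
Variable G : groupType.
Implicit Types A S : {pred G}.

Definition generated A : {pred G} :=
  fun x => `[< forall S, group_closed S -> {subset A <= S} -> x \in S >].

Definition center : {pred G} := fun x => `[< forall y : G, commute x y >].

Definition finite_order : {pred G} :=
  fun x => `[< exists2 n, 0 < n & x ^+ n = 1 >].

Definition torsion : {pred G} := generated finite_order.

Definition derived S : {pred G} :=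
  generated (fun x => `[< exists2 y, y \in S &
                          exists2 z, z \in S & x = [~ y, z] >]).

Definition soluble : Prop := exists n, iter n derived predT =i pred1 1.

Lemma generated_group A : group_closed (generated A).
Proof.
split=> [|x y /asboolP xA /asboolP yA]; apply/asboolP=> S gS AS; first by case: gS.
by have [_ SF] := gS; apply: SF; [apply: xA | apply: yA].
Qed.

Lemma generated_normal A :
  (forall x y : G, x \in A -> x ^ y \in A) -> normal_closed (generated A).
Proof.
move=> AJ; split=> [|x y /asboolP xA]; first exact: generated_group.
apply/asboolP=> S gS AS; pose S' : {pred G} := fun z => z ^ y \in S.
apply: (xA S') => [|z zA]; last exact/AS/AJ.
split=> [|u v]; rewrite !unfold_in ?conj1g; first by case: gS.
by move=> uS vS; rewrite conjMg conjVg; case: gS => _; apply.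
Qed.

Lemma center_group : group_closed center.
Proof.
split=> [|x y /asboolP cx /asboolP cy]; apply/asboolP=> z.
  exact/commute_sym/commute1.
apply/commute_sym/commuteM; first exact/commute_sym.
exact/commuteV/commute_sym.
Qed.

Lemma sub_center_normal S :
  group_closed S -> {subset S <= center} -> normal_closed S.
Proof.
move=> gS sSZ; split=> // x y Sx.
by have /asboolP/(_ y) cxy := sSZ x Sx; rewrite conjgE cxy mulKg.
Qed.

Lemma center_normal : normal_closed center.
Proof. exact: sub_center_normal center_group _. Qed.

Lemma torsion_group : group_closed torsion.
Proof. exact: generated_group. Qed.

Lemma torsion_normal : normal_closed torsion.
Proof.
apply: generated_normal => x y /asboolP[n n0 xn]; apply/asboolP.
by exists n => //; rewrite -conjXg xn conj1g.
Qed.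

End Subgroups.

Arguments center G : clear implicits.
Arguments finite_order G : clear implicits.
Arguments torsion G : clear implicits.
Arguments soluble G : clear implicits.
Arguments center_group G : clear implicits.
Arguments center_normal G : clear implicits.
Arguments torsion_group G : clear implicits.
Arguments torsion_normal G : clear implicits.

(******************************************************************************)
(* Group presentations: the letter (i, false) is the generator x_i, and       *)
(* (i, true) is its formal inverse.                                           *)
(******************************************************************************)

Definition letter n := ('I_n * bool)%type.
Definition word n := seq (letter n).
Definition inv_letter n (a : letter n) : letter n := (a.1, ~~ a.2).
Definition inv_word n (w : word n) : word n := rev (map (@inv_letter n) w).

(* Words representing the same element of < x_0, .., x_{n-1} | R >.           *)
Inductive pres_eq n (R : word n -> Prop) : word n -> word n -> Prop :=
| pres_refl u : pres_eq R u u
| pres_sym u v : pres_eq R u v -> pres_eq R v u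
| pres_trans u v w : pres_eq R u v -> pres_eq R v w -> pres_eq R u w
| pres_cancel u v a : pres_eq R (u ++ a :: inv_letter a :: v) (u ++ v)
| pres_relator u v r : R r -> pres_eq R (u ++ r ++ v) (u ++ v).

Section Presented.
Variables (n : nat) (R : word n -> Prop).

Definition pres_rel : rel (word n) := fun u v => `[< pres_eq R u v >].

Lemma pres_rel_equiv : equiv_class_of pres_rel.
Proof.
split=> [u | u v | v u w]; first exact/asboolP/pres_refl.
  by apply/asboolP/asboolP; apply: pres_sym.
by move=> /asboolP uv /asboolP vw; apply/asboolP; apply: pres_trans vw.
Qed.

Canonical pres_equiv := EquivRelPack pres_rel_equiv.

Definition presented := {eq_quot pres_rel}.

HB.instance Definition _ : EqQuotient (word n) pres_rel presented :=
  EqQuotient.on presented.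
HB.instance Definition _ := Choice.on presented.

Lemma presentedP (u v : word n) :
  reflect (pres_eq R u v) (u == v %[mod presented]).
Proof. by rewrite piE; apply: asboolP. Qed.

Let pres_catl (w u v : word n) : pres_eq R u v -> pres_eq R (w ++ u) (w ++ v).
Proof.
elim=> {u v} [u|u v _|u v z _ uv _|u v a|u v r Rr].
- exact: pres_refl.
- exact: pres_sym.
- exact: pres_trans.
- by rewrite !catA; apply: pres_cancel.
- by rewrite catA (catA w u v); apply: pres_relator.
Qed.

Let pres_catr (w u v : word n) : pres_eq R u v -> pres_eq R (u ++ w) (v ++ w).
Proof.
elim=> {u v} [u|u v _|u v z _ uv _|u v a|u v r Rr].
- exact: pres_refl.
- exact: pres_sym.
- exact: pres_trans.
- by rewrite -!catA; apply: pres_cancel.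
- by rewrite -!catA; apply: pres_relator.
Qed.

Let inv_letterK : involutive (@inv_letter n).
Proof. by case=> i b; rewrite /inv_letter /= negbK. Qed.

Let inv_wordK : involutive (@inv_word n).
Proof. by move=> w; rewrite /inv_word map_rev revK mapK. Qed.

Let pres_mulV (w : word n) : pres_eq R (w ++ inv_word w) [::].
Proof.
elim: w => [|a w IHw]; first exact: pres_refl.
have -> : (a :: w) ++ inv_word (a :: w) =
          [:: a] ++ ((w ++ inv_word w) ++ [:: inv_letter a]).
  by rewrite /inv_word /= rev_cons -cats1 catA.
apply: pres_trans (pres_catl [:: a] (pres_catr [:: inv_letter a] IHw)) _.
exact: (pres_cancel R [::] [::]).
Qed.

Let pres_mulVl (w : word n) : pres_eq R (inv_word w ++ w) [::].
Proof. by rewrite -{2}[w]inv_wordK; apply: pres_mulV. Qed.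

Let pres_inv (u v : word n) :
  pres_eq R u v -> pres_eq R (inv_word u) (inv_word v).
Proof.
move=> uv; apply: (@pres_trans _ _ _ (inv_word u ++ (v ++ inv_word v))).
  rewrite -{1}[inv_word u]cats0.
  exact/pres_catl/pres_sym/pres_mulV.
rewrite catA -{2}[inv_word v]cat0s; apply: pres_catr.
apply: (pres_trans _ (pres_mulVl u)); apply: pres_catl.
exact: pres_sym.
Qed.

Definition presented_one : presented := \pi_presented [::].
Definition presented_mul (a b : presented) : presented := \pi_presented (repr a ++ repr b).
Definition presented_inv (a : presented) : presented := \pi_presented (inv_word (repr a)).

Let repr_mod (u : word n) : pres_eq R (repr (\pi_presented u)) u.
Proof. by apply/presentedP; rewrite reprK. Qed.

Let pi_mul (u v : word n) :
  presented_mul (\pi_presented u) (\pi_presented v) = \pi_presented (u ++ v).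
Proof.
apply/eqP/presentedP.
apply: (pres_trans (pres_catr _ (repr_mod u))); exact/pres_catl/repr_mod.
Qed.

Let pi_inv (u : word n) : presented_inv (\pi_presented u) = \pi_presented (inv_word u).
Proof. exact/eqP/presentedP/pres_inv/repr_mod. Qed.

Let mulA : associative presented_mul.
Proof.
elim/quotW=> u; elim/quotW=> v; elim/quotW=> w.
by rewrite (pi_mul v w) (pi_mul u v) (pi_mul u) (pi_mul _ w) catA.
Qed.
Let mul1 : left_id presented_one presented_mul.
Proof. by elim/quotW=> u; rewrite /presented_one pi_mul. Qed.
Let mulr1 : right_id presented_one presented_mul.
Proof. by elim/quotW=> u; rewrite /presented_one pi_mul cats0. Qed.
Let mulV : left_inverse presented_one presented_inv presented_mul.
Proof.
elim/quotW=> u; rewrite pi_inv pi_mul.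
exact/eqP/presentedP/pres_mulVl.
Qed.
Let mulrV : right_inverse presented_one presented_inv presented_mul.
Proof.
elim/quotW=> u; rewrite pi_inv pi_mul.
exact/eqP/presentedP/pres_mulV.
Qed.

HB.instance Definition _ := isGroup.Build presented mulA mul1 mulr1 mulV mulrV.

Lemma pi_presentedM (u v : word n) :
  \pi_presented (u ++ v) = \pi_presented u * \pi_presented v.
Proof. by rewrite -pi_mul. Qed.

End Presented.

Definition finitely_presented (G : groupType) : Prop :=
  exists n (rels : seq (word n)),
    isomorphic (presented (fun w => w \in rels)) G.

(* The total recursive functions of k arguments: the recursion and            *)
(* minimisation variable is the first argument, and minimisation is only      *)
(* applied to f such that f (y, v) has a zero y for every v.                  *)
Inductive recursive : forall k, (k.-tuple nat -> nat) -> Prop :=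
| recursive_zero k : recursive (fun _ : k.-tuple nat => 0%N)
| recursive_succ : recursive (fun v : 1.-tuple nat => (thead v).+1)
| recursive_proj k (i : 'I_k) : recursive (fun v : k.-tuple nat => tnth v i)
| recursive_comp k m (f : m.-tuple nat -> nat)
    (g : 'I_m -> k.-tuple nat -> nat) :
    recursive f -> (forall i, recursive (g i)) ->
    recursive (fun v => f [tuple g i v | i < m])
| recursive_prim k (f : k.-tuple nat -> nat) (g : k.+2.-tuple nat -> nat)
    (h : k.+1.-tuple nat -> nat) :
    recursive f -> recursive g ->
    (forall v : k.-tuple nat, h [tuple of 0%N :: v] = f v) ->
    (forall y (v : k.-tuple nat),
       h [tuple of y.+1 :: v] = g [tuple of y :: h [tuple of y :: v] :: v]) ->
    recursive h
| recursive_mu k (f : k.+1.-tuple nat -> nat) (h : k.-tuple nat -> nat) :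
    recursive f ->
    (forall v : k.-tuple nat, f [tuple of h v :: v] = 0%N) ->
    (forall (v : k.-tuple nat) y,
       (y < h v)%N -> f [tuple of y :: v] <> 0%N) ->
    recursive h.

Definition rec_enumerable (A : nat -> Prop) : Prop :=
  (forall m, ~ A m) \/
  exists2 f : 1.-tuple nat -> nat, recursive f &
    forall m, A m <-> exists k, f [tuple k] = m.

(* The letters x_i and x_i^-1 are numbered 2 i and 2 i + 1, and sequences of   *)
(* numbers are encoded by the bijection CodeSeq.code : seq nat -> nat.        *)
Definition word_code n (w : word n) : nat :=
  CodeSeq.code [seq (a.1.*2 + a.2)%N | a : letter n <- w].

Definition recursively_presented (G : groupType) : Prop :=
  exists n (R : word n -> Prop),
    rec_enumerable (fun m => exists2 w, R w & word_code w = m) /\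
    isomorphic (presented R) G.

Local Open Scope ring_scope.

Definition zinv (p : nat) : {pred rat} :=
  fun x => `[< exists (a : int) (k : nat), x = a%:~R / p%:R ^+ k >].

Lemma zinv_subring p : subring_closed (zinv p).
Proof.
have intE (a : int) : a%:~R \in zinv p.
  by apply/asboolP; exists a, 0%N; rewrite expr0 divr1.
have nz0 (x : rat) : x \in zinv 0 -> exists a : int, x = a%:~R.
  case/asboolP=> a [[|k] ->]; first by exists a; rewrite expr0 divr1.
  by exists 0; rewrite expr0n invr0 mulr0.
split=> [|x y xS yS|x y xS yS]; first exact: (intE 1).
- have [p0|p0] := eqVneq p 0%N.
    move: xS yS; rewrite p0 => /nz0[a ->] /nz0[b ->].
    by rewrite -rmorphB /= -p0.
  case/asboolP: xS yS => a [k ->] /asboolP[b [l ->]].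
  apply/asboolP; exists (a * p%:Z ^+ l - b * p%:Z ^+ k), (k + l)%N.
  have pk m : p%:R ^+ m != 0 :> rat by rewrite expf_neq0 // pnatr_eq0.
  rewrite rmorphB !rmorphM !rmorphXn /= exprD mulrBl.
  by congr (_ - _); rewrite -!pmulrn; [rewrite -mulf_div divff ?mulr1|
     rewrite [_ ^+ k * _]mulrC -mulf_div divff ?mulr1].
- have [p0|p0] := eqVneq p 0%N.
    move: xS yS; rewrite p0 => /nz0[a ->] /nz0[b ->].
    by rewrite -rmorphM /= -p0.
  case/asboolP: xS yS => a [k ->] /asboolP[b [l ->]].
  apply/asboolP; exists (a * b), (k + l)%N.
  by rewrite rmorphM exprD /= mulf_div.
Qed.

HB.instance Definition _ p :=
  GRing.isSubringClosed.Build rat (zinv p) (zinv_subring p).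

Definition Zinv (p : nat) := {x : rat | x \in zinv p}.

HB.instance Definition _ p := SubChoice.on (Zinv p).
HB.instance Definition _ p := [SubChoice_isSubComNzRing of Zinv p by <:].

Definition multiples (V : zmodType) (r : V) : {pred V} :=
  fun x => `[< exists k : int, x = r *~ k >].

Lemma multiples_zmod (V : zmodType) (r : V) : zmod_closed (multiples r).
Proof.
split=> [|x y /asboolP[k ->] /asboolP[l ->]]; apply/asboolP.
  by exists 0; rewrite mulr0z.
by exists (k - l); rewrite mulrzBr.
Qed.

HB.instance Definition _ (V : zmodType) (r : V) :=
  GRing.isZmodClosed.Build V (multiples r) (multiples_zmod r).

(* The quotient of the additive group Z[1/p] by its subgroup Z r. *)
Definition zinv_mod (p : nat) (r : Zinv p) : groupType :=
  Algebra.to_multiplicative (Quotient.quot (multiples r)).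

Definition power_of (p : nat) : {pred rat} :=
  fun x => `[< exists k : int, x = p%:R ^ k >].

(* The indices 0, 1, 2, 3 : 'I_4 stand for the usual 1, 2, 3, 4. *)
Definition abels_mx (p : nat) : {pred 'M[rat]_4} := fun A =>
  [&& A \is a mxOver (zinv p),
      [forall i : 'I_4, forall j : 'I_4, (j < i)%N ==> (A i j == 0)],
      A 0 0 == 1, A 3 3 == 1, A 1 1 \in power_of p & A 2 2 \in power_of p].

Definition upper_mx (A : 'M[rat]_4) : Prop :=
  forall i j : 'I_4, (j < i)%N -> A i j = 0.

Lemma abels_mxP p (A : 'M[rat]_4) :
  reflect [/\ forall i j, A i j \in zinv p, upper_mx A, A 0 0 = 1 /\ A 3 3 = 1,
              A 1 1 \in power_of p & A 2 2 \in power_of p]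
          (A \in abels_mx p).
Proof.
apply: (iffP and5P) => [[/mxOverP Az Au /eqP-> /eqP-> /andP[-> ->]]|].
  split=> // i j ji; apply/eqP.
  by move/forallP/(_ i)/forallP/(_ j)/implyP: Au; apply.
case=> [Az Au [-> ->] -> ->]; split=> //; first exact/mxOverP.
by apply/forallP=> i; apply/forallP=> j; apply/implyP=> ji; rewrite Au.
Qed.

Lemma upper_mx_diagM (A B : 'M[rat]_4) i :
  upper_mx A -> upper_mx B -> (A *m B) i i = A i i * B i i.
Proof.
move=> Au Bu; rewrite mxE (bigD1 i) //= big1 ?addr0 // => k.
rewrite -val_eqE neq_ltn => /orP[ki | ik]; first by rewrite (Au i k) ?mul0r.
by rewrite (Bu k i) ?mulr0.
Qed.

Lemma upper_mxM (A B : 'M[rat]_4) :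
  upper_mx A -> upper_mx B -> upper_mx (A *m B).
Proof.
move=> Au Bu i j ji; rewrite mxE big1 // => k _.
have [ki | ik] := ltnP k i; first by rewrite Au ?mul0r.
by rewrite (Bu k j) ?mulr0 // (leq_trans ji).
Qed.

Lemma upper_mxV (A : 'M[rat]_4) :
  A \in unitmx -> (forall i, A i i != 0) -> upper_mx A -> upper_mx (invmx A).
Proof.
move=> Aunit Ann Au i j; have [m] := ubnP (j : nat).
elim: m j => // m IHm j; rewrite ltnS => jm ji.
have /matrixP/(_ i j) := mulVmx Aunit.
rewrite !mxE (bigD1 j) //= big1 => [|k]; last first.
  rewrite -val_eqE neq_ltn => /orP[kj | jk]; last by rewrite (Au k j) ?mulr0.
  by rewrite IHm ?mul0r //; [apply: leq_trans kj jm | apply: ltn_trans kj ji].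
rewrite addr0 -val_eqE gtn_eqF // => /eqP.
by rewrite mulf_eq0 (negPf (Ann j)) orbF => /eqP.
Qed.

Section AbelsGroup.
Variables (p : nat) (p_pr : prime p).

Let p_neq0 : p%:R != 0 :> rat.
Proof. by rewrite pnatr_eq0 -lt0n prime_gt0. Qed.

Let zinv_power : {subset power_of p <= zinv p}.
Proof.
move=> x /asboolP[[k|k] ->]; apply/asboolP.
  by exists (p%:R ^+ k), 0%N; rewrite expr0 divr1 rmorphXn /= ?rmorph_nat.
by exists 1, k.+1; rewrite mul1r.
Qed.

Let power1 : 1 \in power_of p.
Proof. by apply/asboolP; exists 0. Qed.

Let powerM x y : x \in power_of p -> y \in power_of p -> x * y \in power_of p.
Proof.
move=> /asboolP[k ->] /asboolP[l ->]; apply/asboolP.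
by exists (k + l); rewrite expfzDr.
Qed.

Let powerV x : x \in power_of p -> x^-1 \in power_of p.
Proof. by move=> /asboolP[k ->]; apply/asboolP; exists (- k); rewrite invr_expz. Qed.

Let power_neq0 x : x \in power_of p -> x != 0.
Proof. by move=> /asboolP[k ->]; rewrite expfz_neq0. Qed.

Let I4P (P : 'I_4 -> Prop) : P 0 -> P 1 -> P 2 -> P 3 -> forall i, P i.
Proof.
move=> P0 P1 P2 P3 [[|[|[|[|//]]]] i4].
- by rewrite (_ : Ordinal _ = 0) //; apply/val_inj.
- by rewrite (_ : Ordinal _ = 1) //; apply/val_inj.
- by rewrite (_ : Ordinal _ = 2) //; apply/val_inj.
- by rewrite (_ : Ordinal _ = 3) //; apply/val_inj.
Qed.

Let abels_diag (A : 'M[rat]_4) i : A \in abels_mx p -> A i i \in power_of p.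
Proof. by case/abels_mxP=> _ _ [A0 A3] A1 A2; move: i; apply: I4P; rewrite ?A0 ?A3. Qed.

Let abels_det (A : 'M[rat]_4) : A \in abels_mx p -> \det A \in power_of p.
Proof.
move=> AH; have [_ Au _ _ _] := abels_mxP _ _ AH.
rewrite -det_tr det_trig; last by apply/is_trig_mxP=> i j ij; rewrite mxE Au.
by elim/big_ind: _ => // i _; rewrite mxE abels_diag.
Qed.

Lemma abels_unitmx (A : 'M[rat]_4) : A \in abels_mx p -> A \in unitmx.
Proof. by move=> AH; rewrite unitmxE unitfE power_neq0 ?abels_det. Qed.

Lemma abels_mx1 : 1%:M \in abels_mx p.
Proof.
apply/abels_mxP; split; rewrite ?mxE //.
- by move=> i j; rewrite mxE rpredMn ?rpred1.
- by move=> i j ji; rewrite mxE -val_eqE gtn_eqF.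
Qed.

Lemma abels_mxM (A B : 'M[rat]_4) :
  A \in abels_mx p -> B \in abels_mx p -> A *m B \in abels_mx p.
Proof.
move=> /abels_mxP[Az Au [A0 A3] A1 A2] /abels_mxP[Bz Bu [B0 B3] B1 B2].
apply/abels_mxP; split; rewrite ?upper_mx_diagM ?A0 ?A3 ?B0 ?B3 ?mulr1 ?powerM //.
  by move=> i j; rewrite mxE rpred_sum // => k _; rewrite rpredM.
exact: upper_mxM.
Qed.

Lemma abels_mxV (A : 'M[rat]_4) :
  A \in abels_mx p -> invmx A \in abels_mx p.
Proof.
move=> AH; have Aunit := abels_unitmx AH.
have Ann i : A i i != 0 by rewrite power_neq0 ?abels_diag.
have [Az Au [A0 A3] A1 A2] := abels_mxP _ _ AH.
have Vu := upper_mxV Aunit Ann Au.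
have Vdiag i : invmx A i i = (A i i)^-1.
  apply: (mulIf (Ann i)); rewrite mulVf // -upper_mx_diagM // mulVmx //.
  by rewrite mxE eqxx.
apply/abels_mxP; split; rewrite ?Vdiag ?A0 ?A3 ?invr1 ?powerV // => i j.
rewrite /invmx Aunit !mxE; apply: rpredM; first exact/zinv_power/powerV/abels_det.
rewrite /cofactor rpredM ?rpredX ?rpredN ?rpred1 //.
rewrite /determinant rpred_sum // => s _.
rewrite rpredM ?rpredX ?rpredN ?rpred1 // rpred_prod // => k _.
by rewrite !mxE.
Qed.

Definition abels of prime p := {A : 'M[rat]_4 | A \in abels_mx p}.
Local Notation H := (abels p_pr).

HB.instance Definition _ := SubChoice.on H.

Definition abels_one : H := Sub 1%:M abels_mx1.
Definition abels_mul (A B : H) : H :=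
  Sub (val A *m val B) (abels_mxM (valP A) (valP B)).
Definition abels_inv (A : H) : H := Sub (invmx (val A)) (abels_mxV (valP A)).

Let mulA : associative abels_mul.
Proof. by move=> A B C; apply/val_inj; rewrite /= mulmxA. Qed.
Let mul1 : left_id abels_one abels_mul.
Proof. by move=> A; apply/val_inj; rewrite /= mul1mx. Qed.
Let mulr1 : right_id abels_one abels_mul.
Proof. by move=> A; apply/val_inj; rewrite /= mulmx1. Qed.
Let mulV : left_inverse abels_one abels_inv abels_mul.
Proof.
by move=> A; apply/val_inj; rewrite /= mulVmx ?(abels_unitmx (valP A)).
Qed.
Let mulrV : right_inverse abels_one abels_inv abels_mul.
Proof.
by move=> A; apply/val_inj; rewrite /= mulmxV ?(abels_unitmx (valP A)).
Qed.

HB.instance Definition _ := isGroup.Build H mulA mul1 mulr1 mulV mulrV.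

End AbelsGroup.

(* Main.v *)
From HB Require Import structures.
Require Import Defs.
From mathcomp Require Import all_boot all_order all_algebra.
From mathcomp Require Import boolp.
From mathcomp Require Import ring.

Set Implicit Arguments.
Unset Strict Implicit.
Unset Printing Implicit Defensive.

Import Order.TTheory GRing.Theory Num.Theory.

Local Open Scope ring_scope.

(** Write X_ij for the root subgroups of H. The torus, generated by
    s = diag(1,p,1,1) and t = diag(1,1,p,1), acts on each X_ij with i < j other
    than the corner X_14 by multiplication of the parameter by nontrivial powers
    of p, so that X_ij consists of the fractional powers of one element x with
    x^d = x^p for some torus element d ([one_param]).

    Finite presentation of H. For every pair of root subgroups whose commutator
    has to be prescribed, other than (X_12, X_24) and (X_13, X_34), some torus
    elements rescale the two parameters independently; the whole commutator
    relation then follows from its instance at the parameters 1 and 1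
    ([zhom_bilinear]). For the two remaining pairs the weights are opposite, and
    the relations come for free: a Hall-Witt argument ([hall_witt]) gives
    [X_12(a), X_24(bc)] = [X_13(ab), X_34(c)], hence both commutators depend
    only on the product of the parameters, and they define a central
    one-parameter subgroup X_14. So in any group satisfying the finitely many
    relations [abels_rel] the products of root and torus elements multiply like
    the matrices of H ([normal_form]), which makes these relations a presentation
    of H ([abels_presentation]). Adding a generator of C as a relator presents G.

    Torsion. The centre is X_14, and H modulo its centre is torsion-free
    ([center_root]); modulo a nontrivial cyclic subgroup every element of X_14 has
    finite order. So Tor(G) is the image of the centre, Z[1/p] modulo Zr. Up to a
    unit of Z[1/p], r is an integer m prime to p, and the quotient contains an
    element of order m, whence m = 1 if it is isomorphic to Z[1/p]/Z.

    The quotient G/Tor(G) is H modulo its centre. It is presented by the relators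
    of H together with one word for each X_14(p^-k); these words are powers of
    letters glued together, so their codes form a recursive sequence
    ([rec_enumerable_family]). It is not finitely presented, because the central
    kernel of a map from a finitely generated group onto a finitely presented one
    is finitely generated ([central_kernel_fg]), while Z[1/p] is not
    ([center_not_fg]). *)

(** * Homomorphisms, images and soluble groups *)

Section Morphisms.
Local Open Scope group_scope.
Variables (G K : groupType) (f : G -> K).
Hypothesis fM : {morph f : x y / x * y}.

Lemma morph_1 : f 1 = 1.
Proof. by apply: (mulgI (f 1)); rewrite -fM !mulg1. Qed.

Lemma morph_V x : f x^-1 = (f x)^-1.
Proof. by apply: (mulgI (f x)); rewrite -fM !mulgV morph_1. Qed.

Lemma morph_X x n : f (x ^+ n) = f x ^+ n.
Proof. by elim: n => [|n IHn]; rewrite ?morph_1 // !expgS fM IHn. Qed.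

Lemma morph_R x y : f [~ x, y] = [~ f x, f y].
Proof. by rewrite /commg /conjg !fM !morph_V. Qed.

Lemma preimage_group (S : {pred K}) :
  group_closed S -> group_closed (fun x => f x \in S).
Proof.
case=> S1 SF; split=> [|x y]; rewrite ?inE /= ?unfold_in ?morph_1 //.
by move=> Sx Sy; rewrite fM morph_V; apply: SF.
Qed.

Lemma isomorphic_of_morph : bijective f -> isomorphic G K.
Proof.
move=> fbij.
pose m := isMultiplicative.Build G K f fM.
by exists (HB.pack_for {multiplicative G -> K} f m).
Qed.

End Morphisms.

(** Two quotients of the same group by the same kernel are isomorphic; stated
    with surjections, this covers every isomorphism needed below. *)
Lemma isomorphic_of_kernels (K A B : groupType) (f : K -> A) (g : K -> B) :
  {morph f : x y / (x * y)%g} -> {morph g : x y / (x * y)%g} ->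
  (forall a, exists x, f x = a) -> (forall b, exists x, g x = b) ->
  (forall x, f x = 1%g <-> g x = 1%g) -> isomorphic A B.
Proof.
move=> fM gM fS gS fg.
have eqfg x y : f x = f y <-> g x = g y.
  have E (L : groupType) (h : K -> L) : {morph h : x y / (x * y)%g} ->
      h x = h y <-> h (x / y)%g = 1%g.
    move=> hM; rewrite hM (morph_V hM).
    by split=> [->|]; [rewrite mulgV | exact: divg1_eq].
  by rewrite (E _ _ fM) (E _ _ gM).
pose s a := projT1 (cid (fS a)); pose t b := projT1 (cid (gS b)).
have sK a : f (s a) = a by rewrite /s; case: (cid _).
have tK b : g (t b) = b by rewrite /t; case: (cid _).
apply: (@isomorphic_of_morph _ _ (g \o s)) => [a b /=|].
  by rewrite -gM; apply/eqfg; rewrite fM !sK.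
exists (f \o t) => [a|b] /=; first by rewrite -[RHS]sK; apply/eqfg; rewrite tK.
by rewrite -[RHS]tK; apply/eqfg; rewrite sK.
Qed.

Section Generated.
Local Open Scope group_scope.
Variable G : groupType.
Implicit Types (A S T : {pred G}) (x y : G).

Lemma mem_generated A x : x \in A -> x \in generated A.
Proof. by move=> Ax; apply/asboolP=> S _; apply. Qed.

Lemma generated_sub A S :
  group_closed S -> {subset A <= S} -> {subset generated A <= S}.
Proof. by move=> gS AS x /asboolP; apply. Qed.

Lemma derived_sub S T : group_closed T ->
  (forall x y, x \in S -> y \in S -> [~ x, y] \in T) ->
  {subset derived S <= T}.
Proof.
move=> gT ST; apply: generated_sub => // x /asboolP[y Sy [z Sz ->]].
exact: ST.
Qed.

Lemma group_closedX S x n : group_closed S -> x \in S -> x ^+ n \in S.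
Proof.
move=> gS Sx; elim: n => [|n IHn]; first by case: gS.
by rewrite expgS; apply: group_closedM.
Qed.

Lemma derived_iter_sub (L : nat -> {pred G}) n :
  (forall i, group_closed (L i)) -> (forall x, x \in L 0%N) ->
  (forall i x y, x \in L i -> y \in L i -> [~ x, y] \in L i.+1) ->
  {subset iter n (@derived G) predT <= L n}.
Proof.
move=> gL L0 Lc; elim: n => [|n IHn] x; first by rewrite L0.
by rewrite iterS; apply: derived_sub => // y z /IHn yL /IHn zL; apply: Lc.
Qed.

(** Such a chain of subgroups contains the derived series term by term, so that
    the derived subgroups need not be computed. *)
Lemma soluble_series (L : nat -> {pred G}) n :
  (forall i, group_closed (L i)) -> (forall x, x \in L 0%N) ->
  (forall i x y, x \in L i -> y \in L i -> [~ x, y] \in L i.+1) ->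
  {subset L n <= pred1 1} -> soluble G.
Proof.
move=> gL L0 Lc Ln; exists n => x; apply/idP/idP=> [/derived_iter_sub|].
  by move/(_ _ gL L0 Lc)/Ln.
move=> /eqP->; case: n {Ln} => // n; rewrite iterS.
by have [] := generated_group (fun x => `[< exists2 y, y \in iter n (@derived G) predT &
  exists2 z, z \in iter n (@derived G) predT & x = [~ y, z] >]).
Qed.

End Generated.

Section SurjectiveMorphism.
Local Open Scope group_scope.
Variables (G K : groupType) (f : G -> K).
Hypothesis fM : {morph f : x y / x * y}.
Hypothesis fS : forall a, exists x, f x = a.

Lemma image_group (S : {pred G}) : group_closed S ->
  group_closed (fun a : K => `[< exists2 x, x \in S & a = f x >]).
Proof.
case=> S1 SF; split=> [|a b /asboolP[x Sx ->] /asboolP[y Sy ->]]; apply/asboolP.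
  by exists 1; rewrite ?(morph_1 fM).
by exists (x / y); rewrite ?SF // fM (morph_V fM).
Qed.

Lemma soluble_image : soluble G -> soluble K.
Proof.
case=> n solG.
pose L i : {pred K} :=
  fun a => `[< exists2 x, x \in iter i (@derived G) predT & a = f x >].
have gL i : group_closed (L i).
  by apply: image_group; case: i => // i; apply: generated_group.
apply: (@soluble_series _ L n) => // [a|i a b|a].
- by have [x <-] := fS a; apply/asboolP; exists x.
- case/asboolP=> x Sx -> /asboolP[y Sy ->]; apply/asboolP.
  exists [~ x, y]; last by rewrite (morph_R fM).
  apply: mem_generated; apply/asboolP; exists x => //; exists y => //.
- by case/asboolP=> x; rewrite solG => /eqP-> ->; rewrite inE (morph_1 fM).
Qed.

End SurjectiveMorphism.

Section QuotientMap.
Local Open Scope group_scope.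
Local Open Scope quotient_scope.
Variables (G : groupType) (S : {pred G}) (nS : normal_closed S).

Definition quotg_map (x : G) : quotg nS := \pi_(quotg nS) x.

Lemma quotg_mapM : {morph quotg_map : x y / x * y}.
Proof. exact: pi_quotgM. Qed.

Lemma quotg_map_surj a : exists x, quotg_map x = a.
Proof. by exists (repr a); apply: reprK. Qed.

Lemma quotg_map_ker x : quotg_map x = 1 <-> x \in S.
Proof.
have -> : (1 : quotg nS) = quotg_map 1 by rewrite (morph_1 quotg_mapM).
rewrite -[x]mul1g -invg1 -(quotgE nS) invg1 mul1g.
by split=> [/esym/eqP | /eqP/esym].
Qed.

End QuotientMap.

(** * Presentations *)

Section Words.
Local Open Scope group_scope.
Variables (n : nat) (G : groupType) (x : 'I_n -> G).

Definition eval_letter (a : letter n) : G := if a.2 then (x a.1)^-1 else x a.1.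
Definition eval_word (w : word n) : G := \prod_(a <- w) eval_letter a.

Lemma eval_word_nil : eval_word [::] = 1.
Proof. by rewrite /eval_word big_nil. Qed.

Lemma eval_word_cons a w : eval_word (a :: w) = eval_letter a * eval_word w.
Proof. by rewrite /eval_word big_cons. Qed.

Lemma eval_word_cat u v : eval_word (u ++ v) = eval_word u * eval_word v.
Proof. by rewrite /eval_word big_cat. Qed.

Lemma eval_letter_inv a : eval_letter (inv_letter a) = (eval_letter a)^-1.
Proof. by case: a => i []; rewrite /eval_letter /= ?invgK. Qed.

Lemma eval_word_inv w : eval_word (inv_word w) = (eval_word w)^-1.
Proof.
elim: w => [|a w IHw]; first by rewrite eval_word_nil invg1.
rewrite /inv_word /= rev_cons -cats1 eval_word_cat IHw !eval_word_cons.
by rewrite eval_word_nil mulg1 eval_letter_inv invgM.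
Qed.

Lemma eval_word_nseq k a : eval_word (nseq k a) = eval_letter a ^+ k.
Proof.
elim: k => [|k IHk] /=; first exact: eval_word_nil.
by rewrite eval_word_cons IHk expgS.
Qed.

(** Equal words differ by conjugates of relators, so their values differ by an
    element of any central subgroup that contains the values of the relators. *)
Lemma eval_word_pres_eq (R : word n -> Prop) (N : {pred G}) :
  group_closed N -> {subset N <= center G} ->
  (forall r, R r -> eval_word r \in N) ->
  forall u v, pres_eq R u v -> (eval_word u)^-1 * eval_word v \in N.
Proof.
move=> gN NZ RN u v.
have NM := group_closedM gN; have NV := group_closedV gN.
elim=> {u v} [u|u v _ uv|u v w _ uv _ vw|u v a|u v r Rr].
- by rewrite mulVg; case: gN.
- by rewrite -[eval_word u]invgK -invgM NV.
- by rewrite -[eval_word w](mulVKg (eval_word v)) mulgA NM.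
- rewrite !eval_word_cat !eval_word_cons eval_letter_inv mulVKg mulVg.
  by case: gN.
- have Nr := RN r Rr; have /NZ/asboolP/(_ (eval_word v)) cr := Nr.
  by rewrite !eval_word_cat cr mulgA invgM mulgVK invgM mulgVK NV.
Qed.

Corollary eval_word_pres (R : word n -> Prop) :
  (forall r, R r -> eval_word r = 1) ->
  forall u v, pres_eq R u v -> eval_word u = eval_word v.
Proof.
move=> R1 u v uv; apply: (mulgI (eval_word u)^-1); apply/esym.
rewrite mulVg; apply/eqP; move: uv.
apply: (@eval_word_pres_eq _ (pred1 1)) => [|y /eqP->|r /R1/eqP//].
  by split=> [|a b /eqP-> /eqP->]; rewrite !inE ?mulgV.
by apply/asboolP=> z; rewrite /commute mul1g mulg1.
Qed.

End Words.

Lemma eval_word_morph n (G K : groupType) (f : G -> K) (x : 'I_n -> G) w :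
  {morph f : a b / (a * b)%g} -> eval_word (f \o x) w = f (eval_word x w).
Proof.
move=> fM; elim: w => [|[i b] w IHw]; first by rewrite !eval_word_nil (morph_1 fM).
rewrite !eval_word_cons fM IHw; congr (_ * _)%g.
by case: b; rewrite /eval_letter //= (morph_V fM).
Qed.

Section Presents.
Local Open Scope group_scope.
Local Open Scope quotient_scope.
Variables (n : nat).
Implicit Types (R : word n -> Prop) (w : word n).

(** The generators x and the relators R present G, expressed on words so that
    no isomorphism has to be carried around. *)
Definition presents (G : groupType) (x : 'I_n -> G) R :=
  (forall g, exists w, eval_word x w = g) /\
  (forall w, eval_word x w = 1 <-> pres_eq R w [::]).

Definition pres_map R w : presented R := \pi_(presented R) w.

Lemma pres_mapP R u v : pres_map R u = pres_map R v <-> pres_eq R u v.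
Proof.
rewrite /pres_map; split=> [/eqP|uv]; first by move/(presentedP R u v).
exact/eqP/(presentedP R u v).
Qed.

Definition pres_gen R (i : 'I_n) : presented R := pres_map R [:: (i, false)].

Lemma eval_pres_gen R w : eval_word (pres_gen R) w = pres_map R w.
Proof.
elim: w => [|[i b] w IHw]; first by rewrite eval_word_nil.
rewrite eval_word_cons IHw -cat1s /pres_map pi_presentedM; congr (_ * _).
case: b => //; apply: mulg1_eq; rewrite -pi_presentedM.
exact/pres_mapP/(pres_cancel R [::] [::]).
Qed.

Lemma pres_gen_relator R r : R r -> eval_word (pres_gen R) r = 1.
Proof.
move=> Rr; rewrite eval_pres_gen; apply/pres_mapP.
by have := pres_relator [::] [::] Rr; rewrite /= cats0.
Qed.

Lemma isomorphic_presents (G : groupType) (x : 'I_n -> G) R :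
  presents x R -> isomorphic (presented R) G.
Proof.
case=> xS xR.
have xE u v : pres_eq R u v -> eval_word x u = eval_word x v.
  apply: eval_word_pres => r Rr.
  by apply/xR; have := pres_relator [::] [::] Rr; rewrite /= cats0.
pose f (q : presented R) := eval_word x (repr q).
have fE w : f (pres_map R w) = eval_word x w.
  by apply/xE/pres_mapP; apply: reprK.
apply: (@isomorphic_of_kernels (presented R) _ _ id f) => // [|a|g|q].
- elim/quotW=> u; elim/quotW=> v; rewrite -/(pres_map R u) -/(pres_map R v).
  by rewrite -pi_presentedM !fE eval_word_cat.
- by exists a.
- by have [w <-] := xS g; exists (pres_map R w).
- elim/quotW: q => w; rewrite -/(pres_map R w) fE xR -pres_mapP.
  by rewrite -!eval_pres_gen eval_word_nil.
Qed.

(** A map N that is equivariant for the generators is a section of the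
    evaluation: it sends the value of w to the class of w, hence no relation
    is lost. *)
Lemma presents_section (G : groupType) (x : 'I_n -> G) R
    (N : G -> presented R) :
  (forall g, exists w, eval_word x w = g) ->
  (forall r, R r -> eval_word x r = 1) ->
  N 1 = 1 -> (forall i g, N (x i * g) = pres_gen R i * N g) ->
  presents x R.
Proof.
move=> xS xR N1 NM; split=> // w.
split=> [w1 | /(eval_word_pres xR)->]; last exact: eval_word_nil.
have NE u : N (eval_word x u) = eval_word (pres_gen R) u.
  elim: u => [|[i b] u IHu]; first by rewrite !eval_word_nil.
  rewrite !eval_word_cons -IHu /eval_letter /=; case: b => //.
  by apply: (mulgI (pres_gen R i)); rewrite -NM !mulVKg.
apply/pres_mapP; rewrite -eval_pres_gen -NE w1 N1.
by rewrite -eval_pres_gen eval_word_nil.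
Qed.

(** Killing a subgroup that is generated by the values of the words S adds
    exactly the relators S. *)
Lemma presents_quotient (G K : groupType) (x : 'I_n -> G) R
    (f : G -> K) (S : word n -> Prop) :
  presents x R -> {morph f : a b / a * b} ->
  (forall a, exists g, f g = a) -> (forall w, S w -> f (eval_word x w) = 1) ->
  (forall T : {pred G}, group_closed T -> (forall w, S w -> eval_word x w \in T) ->
     forall g, f g = 1 -> g \in T) ->
  presents (f \o x) (fun w => R w \/ S w).
Proof.
move=> [xS xR] fM fS Sf kerf; split=> [a | w].
  by have [g <-] := fS a; have [w <-] := xS g; exists w; rewrite eval_word_morph.
set R' := fun _ => _.
have RR' u v : pres_eq R u v -> pres_eq R' u v.
  elim=> {u v} [u|u v _|u v z _ + _|u v a|u v r Rr].
  - exact: pres_refl.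
  - exact: pres_sym.
  - exact: pres_trans.
  - exact: pres_cancel.
  - by apply: pres_relator; left.
split=> [|/eval_word_pres E].
  rewrite eval_word_morph //.
  pose T : {pred G} := fun g => `[< forall w, eval_word x w = g -> pres_eq R' w [::] >].
  have T1 u : pres_eq R' u [::] <-> eval_word (pres_gen R') u = 1.
    by rewrite eval_pres_gen -pres_mapP -[pres_map R' [::]]eval_pres_gen eval_word_nil.
  have gT : group_closed T.
    split=> [|g h /asboolP Tg /asboolP Th]; apply/asboolP=> u uE.
      exact/RR'/xR.
    have [v vE] := xS h; apply/T1; apply: (mulIg (eval_word (pres_gen R') v)).
    rewrite -eval_word_cat; have /T1 -> := Th v vE; rewrite mulg1.
    by apply/T1/Tg; rewrite eval_word_cat uE vE mulgVK.
  move=> fw; suff ST s : S s -> eval_word x s \in T.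
    by have /asboolP/(_ w erefl) := kerf T gT ST _ fw.
  move=> Ss; apply/asboolP=> u uE; apply/T1.
  have us : eval_word x (u ++ inv_word s) = 1.
    by rewrite eval_word_cat eval_word_inv uE mulgV.
  move/xR/RR'/T1: us; rewrite eval_word_cat eval_word_inv => /divg1_eq->.
  by apply: pres_gen_relator; right.
rewrite E ?eval_word_nil // => r; rewrite eval_word_morph // => -[Rr|/Sf//].
suff -> : eval_word x r = 1 by rewrite (morph_1 fM).
by apply/xR; have := pres_relator [::] [::] Rr; rewrite /= cats0.
Qed.

End Presents.

(** If a finitely generated group G maps onto a finitely presented group with
    central kernel, the kernel is finitely generated: it is generated by the
    values of the finitely many relators at lifts of the generators, and by the
    defects of expressing the generators of G through those lifts. *)
Lemma central_kernel_fg m (G K : groupType) (x : 'I_m -> G) (f : G -> K) :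
  (forall g, exists w, eval_word x w = g) ->
  {morph f : a b / (a * b)%g} -> (forall a, exists g, f g = a) ->
  (forall g, f g = 1%g -> g \in center G) -> finitely_presented K ->
  exists2 s : seq G, {in s, forall z, f z = 1%g} &
    forall T : {pred G}, group_closed T -> {subset s <= T} ->
      forall g, f g = 1%g -> g \in T.
Proof.
move=> xS fM fS fZ [n [rels [h [h' hK h'K]]]].
set R := fun w => _ in h h' hK h'K.
have hM : {morph h : a b / (a * b)%g} by exact: gmulfM.
pose y i := projT1 (cid (fS (h (pres_gen R i)))).
have fy i : f (y i) = h (pres_gen R i) by rewrite /y; case: (cid _).
have fyE w : f (eval_word y w) = h (pres_map R w).
  rewrite -eval_word_morph // -eval_pres_gen -eval_word_morph //.
  by congr eval_word; apply/funext=> i; apply: fy.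
pose v j : word n := repr (h' (f (x j))).
have vE j : f (eval_word y (v j)) = f (x j).
  by rewrite fyE -[RHS]h'K; congr (h _); apply: reprK.
pose s := [seq ((eval_word y (v j))^-1 * x j)%g | j <- enum 'I_m] ++
          [seq eval_word y r | r <- rels].
have sf : {in s, forall z, f z = 1%g}.
  move=> z; rewrite mem_cat => /orP[] /mapP[].
    by move=> j _ ->; rewrite fM (morph_V fM) vE mulVg.
  move=> r Rr ->; rewrite fyE -eval_pres_gen (_ : eval_word _ _ = 1%g).
    exact: morph_1.
  exact: pres_gen_relator.
exists s => // T gT sT g fg1.
pose N := generated (mem s).
have gN : group_closed N by apply: generated_group.
have NT : {subset N <= T} by apply: generated_sub.
have NZ : {subset N <= center G}.
  by apply: generated_sub (center_group G) _ => z /sf/fZ.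
have sN z : z \in s -> z \in N by apply: mem_generated.
have NM := group_closedM gN; have NV := group_closedV gN.
pose P g := exists w, exists2 z, z \in N & g = (eval_word y w * z)%g.
have PM a b : P a -> P b -> P (a * b)%g.
  move=> [u [z Nz ->]] [w [z' Nz' ->]]; exists (u ++ w), (z * z')%g; first exact: NM.
  have /NZ/asboolP/(_ (eval_word y w)) cz := Nz.
  by rewrite eval_word_cat !mulgA -(mulgA _ z (eval_word y w)) cz !mulgA.
have PV a : P a -> P a^-1%g.
  move=> [u [z Nz ->]]; exists (inv_word u), z^-1%g; first exact: NV.
  have /NZ/asboolP/(_ (eval_word y (inv_word u))) cz := NV _ Nz.
  by rewrite invgM -eval_word_inv cz.
have Px j : P (x j).
  exists (v j), ((eval_word y (v j))^-1 * x j)%g; last by rewrite mulVKg.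
  by apply: sN; rewrite mem_cat; apply/orP; left; apply/mapP; exists j; rewrite ?mem_enum.
have PE w : P (eval_word x w).
  elim: w => [|[j b] w IHw].
    by exists [::], 1%g; [case: gN | rewrite !eval_word_nil mulg1].
  by rewrite eval_word_cons; apply: PM => //; case: b; [apply: PV (Px j) | apply: Px].
have [w0 w0E] := xS g; have [w [z Nz gE]] := PE w0.
apply: NT; rewrite -w0E gE; apply: (NM) => //.
rewrite w0E in gE; have : f (eval_word y w) = 1%g.
  move: fg1; rewrite gE fM [f z](_ : _ = 1%g) ?mulg1 //.
  suff /(_ z Nz) : {subset N <= (fun a => f a \in pred1 (1%g : K))} by move/eqP.
  apply: generated_sub => [|a /sf/eqP//]; apply: (preimage_group fM).
  by split=> [|a b /eqP-> /eqP->]; rewrite !inE ?mulgV.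
rewrite fyE -(morph_1 hM) => /(can_inj hK) w1.
have /eval_word_pres_eq E : pres_eq R w [::].
  by apply/pres_mapP; rewrite w1 -[RHS]eval_pres_gen eval_word_nil.
rewrite -[eval_word y w]invgK; apply: NV.
rewrite -[X in X \in N]mulg1 -(eval_word_nil y); apply: E => // r Rr.
by apply: sN; rewrite mem_cat; apply/orP; right; apply/mapP; exists r.
Qed.

(** * One-parameter subgroups over Z[1/p] *)

Section ZinvElements.
Variables (p : nat) (p_gt0 : (0 < p)%N).

Lemma pR_neq0 : p%:R != 0 :> rat.
Proof. by rewrite pnatr_eq0 -lt0n. Qed.

Lemma zinv_expz (e : int) : p%:R ^ e \in zinv p.
Proof.
apply/asboolP; case: e => k.
  by exists (p%:R ^+ k), 0%N; rewrite expr0 divr1 rmorphXn /= ?rmorph_nat.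
by exists 1, k.+1; rewrite mul1r.
Qed.

(** The elements p^-k generate the additive group Z[1/p]. *)
Lemma zinv_ind (P : rat -> Prop) :
  P 0 ->
  (forall a b, a \in zinv p -> b \in zinv p -> P a -> P b -> P (a + b)) ->
  (forall a, a \in zinv p -> P a -> P (- a)) ->
  (forall k : nat, P (p%:R ^ (- k%:Z))) ->
  forall a, a \in zinv p -> P a.
Proof.
move=> P0 PD PN Pk a /asboolP[n [k ->]].
have zk : p%:R ^ (- k%:Z) \in zinv p by apply: zinv_expz.
have zM m : p%:R ^ (- k%:Z) *+ m \in zinv p by rewrite rpredMn.
have PM m : P (p%:R ^ (- k%:Z) *+ m).
  by elim: m => // m IHm; rewrite mulrS; apply: PD.
rewrite -[X in _ / X]/(p%:R ^ k%:Z) invr_expz mulrC mulrzr.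
by case: n => m; [apply: PM | apply: PN].
Qed.

End ZinvElements.

Section ZinvMorphisms.
Variable p : nat.

Lemma zinv_sub a : a \in zinv p -> exists b : Zinv p, val b = a.
Proof. by move=> za; exists (Sub a za); rewrite SubK. Qed.

Section AdditiveToMultiplicative.
Variables (V : zmodType) (G : groupType) (E : V -> G).
Hypothesis ED : {morph E : a b / a + b >-> (a * b)%g}.

Lemma add_morph0 : E 0 = 1%g.
Proof. by apply: (mulgI (E 0)); rewrite -ED addr0 mulg1. Qed.

Lemma add_morphN a : E (- a) = (E a)^-1%g.
Proof. by apply: (mulgI (E a)); rewrite -ED subrr add_morph0 mulgV. Qed.

Lemma add_morphX a n : E (a *+ n) = (E a ^+ n)%g.
Proof. by elim: n => [|n IHn]; rewrite ?add_morph0 // mulrS ED IHn expgS. Qed.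

End AdditiveToMultiplicative.

(** The induction over the generators p^-k of Z[1/p], for images in a group. *)
Lemma zinv_morph_ind (G : groupType) (E : Zinv p -> G) (P : G -> Prop) :
  {morph E : a b / a + b >-> (a * b)%g} ->
  (forall x y, P x -> P y -> P (x * y)%g) -> (forall x, P x -> P x^-1%g) ->
  (forall (k : nat) a, val a = p%:R ^ (- k%:Z) -> P (E a)) ->
  forall a, P (E a).
Proof.
move=> ED PM PV Pk a.
pose Q x := forall a, val a = x -> P (E a).
suff Qz x : x \in zinv p -> Q x by apply: (Qz _ (valP a)).
apply: zinv_ind => {x a}.
- move=> a a0; have -> : a = 1 - 1 by apply: val_inj; rewrite subrr a0 rmorph0.
  have P1 : P (E 1) by apply: (Pk 0%N); rewrite oppr0 expr0z rmorph1.
  by rewrite ED add_morphN //; apply: PM => //; apply: PV.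
- move=> x y /zinv_sub[b bx] /zinv_sub[c cy] Px Py a ac.
  have -> : a = b + c by apply: val_inj; rewrite ac rmorphD /= bx cy.
  by rewrite ED; apply: PM; [apply: Px | apply: Py].
- move=> x /zinv_sub[b bx] Px a ax.
  have -> : a = - b by apply: val_inj; rewrite ax rmorphN /= bx.
  by rewrite add_morphN //; apply/PV/Px.
- exact: Pk.
Qed.

End ZinvMorphisms.

Section OneParameter.
Local Open Scope group_scope.
Variables (p : nat) (p_gt0 : (0 < p)%N) (G : groupType).
Implicit Types (X Y Z : rat -> G) (g h d s t : G).
Local Notation zp := (zinv p).
Local Notation pw e := ((p%:R : rat) ^ e)%R.

Definition zhom X := {in zp &, forall a b, X (a + b)%R = X a * X b}.

(** The element g normalises X and e is its weight, as for an element of the torus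
    and a root subgroup. *)
Definition acts g X (e : int) := {in zp, forall a, X a ^ g = X (pw e * a)%R}.

Let pwz e a : a \in zp -> (pw e * a)%R \in zp.
Proof. by move=> za; rewrite rpredM // zinv_expz. Qed.

Let zp0 : 0%R \in zp := rpred0 _.
Let zp1 : 1%R \in zp := rpred1 _.

Lemma zhom0 X : zhom X -> X 0%R = 1.
Proof. by move=> XD; apply: (mulgI (X 0%R)); rewrite -XD // addr0 mulg1. Qed.

Lemma zhomN X a : zhom X -> a \in zp -> X (- a)%R = (X a)^-1.
Proof.
move=> XD za; apply: (mulgI (X a)).
by rewrite -XD ?rpredN // subrr zhom0 ?mulgV.
Qed.

Lemma zhomMn X a n : zhom X -> a \in zp -> X (a *+ n)%R = X a ^+ n.
Proof.
move=> XD za; elim: n => [|n IHn]; first by rewrite mulr0n zhom0.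
by rewrite mulrS XD ?rpredMn // IHn expgS.
Qed.

Lemma zhom1 : zhom (fun=> 1).
Proof. by move=> a b _ _; rewrite mulg1. Qed.

Lemma acts1 g e : acts g (fun=> 1) e.
Proof. by move=> a _; rewrite conj1g. Qed.

Lemma acts_mul g h X e f : acts g X e -> acts h X f -> acts (g * h) X (e + f)%R.
Proof.
move=> gX hX a za; rewrite conjgM gX // hX ?pwz // mulrA.
by rewrite -expfzDr ?pR_neq0 // addrC.
Qed.

Lemma acts_inv g X e : acts g X e -> acts g^-1 X (- e)%R.
Proof.
move=> gX a za; apply: (can_inj (conjgK g)); rewrite conjgKV gX ?pwz //.
by rewrite mulrA -expfzDr ?pR_neq0 // subrr mul1r.
Qed.

Lemma conjgX_iter g X e k a : acts g X e -> a \in zp ->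
  X a ^ (g ^+ k) = X (pw (e *~ k) * a)%R.
Proof.
move=> gX za; elim: k => [|k IHk]; first by rewrite conjg1 mul1r.
rewrite expgSr conjgM IHk gX ?pwz // mulrA -expfzDr ?pR_neq0 //.
by rewrite intS mulrzDr mulr1z.
Qed.

(** Conjugating by d sufficiently often makes every parameter integral, so an
    equivariant homomorphism is determined by its value at 1. *)
Lemma zhom_uniq X Y d : zhom X -> zhom Y -> acts d X 1 -> acts d Y 1 ->
  X 1%R = Y 1%R -> forall a, a \in zp -> X a = Y a.
Proof.
move=> XD YD dX dY XY1; apply: (@zinv_ind p (fun a => X a = Y a)).
- by rewrite !zhom0.
- by move=> a b za zb Xa Xb; rewrite XD // YD // Xa Xb.
- by move=> a za Xa; rewrite !zhomN // Xa.
move=> k; have zk := zinv_expz p (- k%:Z)%R.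
apply: (can_inj (conjgK (d ^+ k))); rewrite !(@conjgX_iter _ _ 1) //.
by rewrite -expfzDr ?pR_neq0 // intz subrr.
Qed.

Lemma acts_from1 X d g e : zhom X -> acts d X 1 -> commute g d ->
  X 1%R ^ g = X (pw e) -> acts g X e.
Proof.
move=> XD dX cgd X1; apply: (@zhom_uniq (fun a => X a ^ g) (fun a => X (pw e * a)%R) d).
- by move=> a b za zb; rewrite XD // conjMg.
- by move=> a b za zb; rewrite mulrDr XD // pwz.
- by move=> a za; rewrite -conjgM cgd conjgM dX.
- by move=> a za; rewrite dX ?pwz // mulrCA.
- by rewrite mulr1.
Qed.

(** Two one-parameter groups whose values commute up to a third one: enough at
    the parameters 1 and 1, once two elements of G rescale the two parameters
    independently. Taking Z trivial gives a criterion for commutation. *)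
Lemma zhom_bilinear X Y Z s t :
  zhom X -> zhom Y -> zhom Z ->
  {in zp &, forall a b, commute (Z a) (X b)} ->
  {in zp &, forall a b, commute (Z a) (Y b)} ->
  acts s X 1 -> acts s Y 0 -> acts s Z 1 ->
  acts t X 0 -> acts t Y 1 -> acts t Z 1 ->
  X 1%R * Y 1%R = Z 1%R * (Y 1%R * X 1%R) ->
  {in zp &, forall a b, X a * Y b = Z (a * b)%R * (Y b * X a)}.
Proof.
move=> XD YD ZD ZX ZY sX sY sZ tX tY tZ XY1.
pose C a b := X a * Y b = Z (a * b)%R * (Y b * X a).
have zk k : pw (- (k%:Z)) \in zp by exact: zinv_expz.
have Cs k b : b \in zp -> C 1%R b -> C (pw (- (k%:Z))) b.
  move=> zb C1; apply: (can_inj (conjgK (s ^+ k))); rewrite /C !conjMg.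
  rewrite (conjgX_iter k sX) // (conjgX_iter k sY) // (conjgX_iter k sZ) ?rpredM //.
  by rewrite mul0rz expr0z mul1r mulrA -expfzDr ?pR_neq0 // intz subrr mul1r -[b in Z b]mul1r.
have Ct k a : a \in zp -> C a 1%R -> C a (pw (- (k%:Z))).
  move=> za C1; apply: (can_inj (conjgK (t ^+ k))); rewrite /C !conjMg.
  rewrite (conjgX_iter k tX) // (conjgX_iter k tY) // (conjgX_iter k tZ) ?rpredM //.
  rewrite mul0rz expr0z mul1r mulrCA -expfzDr ?pR_neq0 // intz subrr mulr1.
  by rewrite -[a in Z a]mulr1.
have CDl a a' b : a \in zp -> a' \in zp -> b \in zp ->
    C a b -> C a' b -> C (a + a')%R b.
  rewrite /C => za za' zb Ca Ca'; have zab := rpredM za zb.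
  have zab' := rpredM za' zb.
  rewrite XD // mulrDl ZD // -mulgA Ca' 2!mulgA -(ZX _ _ zab' za) -(mulgA (Z _)).
  by rewrite Ca !mulgA -(ZD _ _ zab' zab) // addrC ZD.
have CDr a b b' : a \in zp -> b \in zp -> b' \in zp ->
    C a b -> C a b' -> C a (b + b')%R.
  rewrite /C => za zb zb' Cb Cb'; have zab := rpredM za zb.
  have zab' := rpredM za zb'.
  rewrite YD // mulrDr ZD // mulgA Cb -!mulgA Cb'.
  by rewrite (mulgA (Y b) (Z _)) -(ZY _ _ zab' zb) !mulgA.
have CNl a b : a \in zp -> b \in zp -> C a b -> C (- a)%R b.
  rewrite /C => za zb Ca; have zab := rpredM za zb.
  rewrite mulNr !zhomN //; apply: (mulgI (X a)); rewrite mulVKg.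
  rewrite mulgA (commuteV (commute_sym (ZX _ _ zab za))) -mulgA.
  by apply: (mulgI (Z (a * b)%R)); rewrite mulVKg [X a * _]mulgA Ca !mulgA mulgK.
have CNr a b : a \in zp -> b \in zp -> C a b -> C a (- b)%R.
  rewrite /C => za zb Cb; have zab := rpredM za zb.
  rewrite mulrN !zhomN //; apply: (mulIg (Y b)); rewrite mulgVK.
  apply: (mulgI (Z (a * b)%R)); rewrite -!mulgA mulVKg.
  apply: (mulgI (Y b)); rewrite mulVKg Cb.
  by rewrite mulgA -(ZY _ _ zab zb) -mulgA.
have C0l b : C 0%R b by rewrite /C mul0r (zhom0 XD) (zhom0 ZD) !mul1g mulg1.
have C0r a : C a 0%R by rewrite /C mulr0 (zhom0 YD) (zhom0 ZD) !mul1g mulg1.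
have C1 b : b \in zp -> C 1%R b.
  move: b; apply: (@zinv_ind p (C 1%R)) => //.
  - by move=> *; apply: CDr.
  - by move=> *; apply: CNr.
  by move=> k; apply: Ct; rewrite // /C mulr1.
move=> a b za zb; move: a za; apply: (@zinv_ind p (C^~ b)) => //.
- by move=> *; apply: CDl.
- by move=> *; apply: CNl.
- by move=> k; apply: Cs => //; apply: C1.
Qed.

Lemma zhom_centralise X Y s t : zhom X -> zhom Y ->
  acts s X 1 -> acts s Y 0 -> acts t X 0 -> acts t Y 1 ->
  commute (X 1%R) (Y 1%R) -> {in zp &, forall a b, commute (X a) (Y b)}.
Proof.
move=> XD YD sX sY tX tY XY1 a b za zb.
have := @zhom_bilinear X Y (fun=> 1) s t XD YD zhom1.
rewrite mul1g => /(_ _ _ sX sY (@acts1 _ _) tX tY (@acts1 _ _) XY1 a b za zb).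
rewrite mul1g; apply => c e _ _; exact/commute_sym/commute1.
Qed.

(** ** The one-parameter group through an element x with x^d = x^p *)

(* The subgroup generated by d and x is a quotient of the Baumslag-Solitar group
   BS(1,p), in which the conjugates of x by the powers of d generate a copy of
   Z[1/p]. *)

Section Construction.
Variables (d x : G) (xd : x ^ d = x ^+ p).

(** The relation y = x^a, where the exponent a is a difference of natural numbers
    divided by p^k, and conjugation by d^k raises y to the power p^k. *)
Definition zroot (a : rat) y := exists n m k : nat,
  a = ((n%:R - m%:R) / p%:R ^+ k)%R /\ y ^ (d ^+ k) = x ^+ n / x ^+ m.

Let xdk k n m : (x ^+ n / x ^+ m) ^ (d ^+ k) = x ^+ (p ^ k * n) / x ^+ (p ^ k * m).
Proof.
have E j : (x ^+ j) ^ (d ^+ k) = x ^+ (p ^ k * j).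
  elim: k j => [|k IHk] j; first by rewrite conjg1 mul1n.
  by rewrite expgSr conjgM IHk conjXg xd -expgnA expnS mulnA.
by rewrite conjMg conjVg !E.
Qed.

Let powF n m n' m' : (n + m' = n' + m)%N -> x ^+ n / x ^+ m = x ^+ n' / x ^+ m'.
Proof.
move=> E; apply: (mulIg (x ^+ m)); rewrite mulgVK.
apply: (mulIg (x ^+ m')); rewrite -expgnDr E.
rewrite expgnDr -!mulgA; congr (_ * _).
by rewrite -expgnDr addnC expgnDr mulKg.
Qed.

Let zroot_uniq a y z : zroot a y -> zroot a z -> y = z.
Proof.
move=> [n [m [k [-> yE]]]] [n' [m' [k' [aE zE]]]].
apply: (can_inj (conjgK (d ^+ (k + k')))).
rewrite [in LHS]expgnDr addnC [in RHS]expgnDr !conjgM yE zE !xdk; apply: powF.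
have pn j : ((p%:R : rat) ^+ j != 0)%R by rewrite expf_neq0 ?pR_neq0.
move/eqP: aE; rewrite eqr_div ?pn // => /eqP aE.
apply/eqP; rewrite -(eqr_nat rat) !natrD !natrM !natrX.
by rewrite -subr_eq0 -[X in _ == X](subrr ((n%:R - m%:R) * p%:R ^+ k')%R) {2}aE; apply/eqP; ring.
Qed.

Let zroot_ex a : a \in zp -> exists y, zroot a y.
Proof.
case/asboolP=> j [k ->].
suff [n [m ->]] : exists n m : nat, j = (n%:Z - m%:Z)%R.
  exists ((x ^+ n / x ^+ m) ^ (d ^+ k)^-1), n, m, k.
  by rewrite conjgKV rmorphB.
by case: j => n; [exists n, 0%N; rewrite subr0 | exists 0%N, n.+1; rewrite sub0r].
Qed.

Let zroot_mul a b y z : zroot a y -> zroot b z -> zroot (a + b)%R (y * z).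
Proof.
move=> [n [m [k [-> yE]]]] [n' [m' [k' [-> zE]]]].
exists (p ^ k' * n + p ^ k * n')%N, (p ^ k' * m + p ^ k * m')%N, (k + k')%N.
split; last first.
  rewrite conjMg {1}expgnDr [in z ^ _]addnC [in z ^ _]expgnDr !conjgM yE zE !xdk.
  rewrite -mulgA (mulgA _ (x ^+ _)).
  rewrite -(commuteV (commuteX2 (p ^ k * n') (p ^ k' * m) (commute_refl x))).
  by rewrite !mulgA -expgnDr -mulgA -invgM -expgnDr [X in _ / x ^+ X]addnC.
have pn j : ((p%:R : rat) ^+ j != 0)%R by rewrite expf_neq0 ?pR_neq0.
by rewrite addf_div // !natrD !natrM !natrX exprD; congr (_ / _)%R; ring.
Qed.

Definition one_param (a : rat) : G :=
  if pselect (exists y, zroot a y) is left h then projT1 (cid h) else 1.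

Let one_paramE a y : zroot a y -> one_param a = y.
Proof.
move=> ay; rewrite /one_param; case: pselect => [h|[]]; last by exists y.
by case: (cid h) => z /= az; apply: zroot_uniq az ay.
Qed.

Lemma one_param_hom : zhom one_param.
Proof.
move=> a b /zroot_ex[y ay] /zroot_ex[z bz].
by rewrite (one_paramE ay) (one_paramE bz); apply/one_paramE/zroot_mul.
Qed.

Lemma one_param1 : one_param 1%R = x.
Proof.
apply: one_paramE; exists 1%N, 0%N, 0%N; split; first by rewrite expr0 divr1 subr0.
by rewrite conjg1 invg1 mulg1.
Qed.

Lemma one_param_acts : acts d one_param 1.
Proof.
move=> a /zroot_ex[y ay]; rewrite (one_paramE ay); apply/esym/one_paramE.
case: ay => n [m [k [-> yE]]]; exists (p * n)%N, (p * m)%N, k; split.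
  by rewrite !natrM -mulrBr mulrA expr1z.
by rewrite -conjgM -expgS expgSr conjgM yE (xdk 1) expn1.
Qed.

End Construction.

End OneParameter.

(** * Groups satisfying Abels' relations *)

Section AbelsRelations.
Local Open Scope group_scope.

(** The x_ij stand for the elementary matrices 1 + e_ij; x13 and x24 are
    commutators, kept as generators so that every relation is short. The corner
    has neither a generator nor a relation. *)
Record abels_rel p (G : groupType) (s t x12 x23 x34 x13 x24 : G) : Prop := AbelsRel {
  rel_st : s * t = t * s;
  rel_12s : x12 * s = s * x12 ^+ p;
  rel_12t : x12 * t = t * x12;
  rel_23s : s * x23 = x23 ^+ p * s;
  rel_23t : x23 * t = t * x23 ^+ p;
  rel_34s : x34 * s = s * x34;
  rel_34t : t * x34 = x34 ^+ p * t;
  rel_13s : x13 * s = s * x13;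
  rel_13t : x13 * t = t * x13 ^+ p;
  rel_24s : s * x24 = x24 ^+ p * s;
  rel_24t : x24 * t = t * x24;
  rel_12_34 : x12 * x34 = x34 * x12;
  rel_12_13 : x12 * x13 = x13 * x12;
  rel_23_13 : x23 * x13 = x13 * x23;
  rel_23_24 : x23 * x24 = x24 * x23;
  rel_34_24 : x34 * x24 = x24 * x34;
  rel_13_24 : x13 * x24 = x24 * x13;
  rel_12_23 : x12 * x23 = x13 * (x23 * x12);
  rel_23_34 : x23 * x34 = x24 * (x34 * x23)
}.

Definition gexpz (G : groupType) (g : G) (k : int) : G :=
  match k with Posz n => g ^+ n | Negz n => g ^- n.+1 end.

Lemma gexpzS (G : groupType) (g : G) k : g * gexpz g k = gexpz g (1 + k)%R.
Proof.
case: k => [n|[|n]]; first by rewrite -expgS.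
  by rewrite /= expg1 mulgV.
rewrite (_ : (1 + Negz n.+1)%R = Negz n) /=.
  by rewrite expgSr invgM mulVKg.
by rewrite !NegzE [in LHS]intS opprD addrA subrr add0r.
Qed.

Variables (p : nat) (p_gt0 : (0 < p)%N) (G : groupType).
Variables s t x12 x23 x34 x13 x24 : G.
Hypothesis rel : abels_rel p s t x12 x23 x34 x13 x24.
Local Notation zp := (zinv p).

Let X12 := one_param p s x12.
Let X23 := one_param p t x23.
Let X34 := one_param p t^-1 x34.
Let X13 := one_param p t x13.
Let X24 := one_param p s^-1 x24.

Let zp0 : 0%R \in zp := rpred0 _.
Let zp1 : 1%R \in zp := rpred1 _.

Let relJ (x d : G) : x * d = d * x ^+ p -> x ^ d = x ^+ p.
Proof. by move=> E; rewrite conjgE E mulKg. Qed.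

Let relJV (x d : G) : d * x = x ^+ p * d -> x ^ d^-1 = x ^+ p.
Proof. by move=> E; rewrite conjgE invgK mulgA E mulgK. Qed.

Let J12 := relJ (rel_12s rel).
Let J23 := relJ (rel_23t rel).
Let J34 := relJV (rel_34t rel).
Let J13 := relJ (rel_13t rel).
Let J24 := relJV (rel_24s rel).

Let D12 : zhom p X12 := one_param_hom p_gt0 J12.
Let D23 : zhom p X23 := one_param_hom p_gt0 J23.
Let D34 : zhom p X34 := one_param_hom p_gt0 J34.
Let D13 : zhom p X13 := one_param_hom p_gt0 J13.
Let D24 : zhom p X24 := one_param_hom p_gt0 J24.

Let E12 : X12 1%R = x12 := one_param1 p_gt0 J12.
Let E23 : X23 1%R = x23 := one_param1 p_gt0 J23.
Let E34 : X34 1%R = x34 := one_param1 p_gt0 J34.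
Let E13 : X13 1%R = x13 := one_param1 p_gt0 J13.
Let E24 : X24 1%R = x24 := one_param1 p_gt0 J24.

Let st : commute s t := rel_st rel.

(* A torus element that fixes the value at 1 has weight 0. *)
Let acts_fix X (d g : G) : zhom p X -> acts p d X 1 -> commute g d ->
  X 1%R * g = g * X 1%R -> acts p g X 0.
Proof.
by move=> XD dX cgd E; apply: (acts_from1 p_gt0 XD dX cgd); rewrite conjgE E mulKg.
Qed.

Let s12 : acts p s X12 1 := one_param_acts p_gt0 J12.
Let t12 : acts p t X12 0.
Proof. apply: (acts_fix D12 s12); [exact: commute_sym | rewrite E12; exact: rel_12t rel]. Qed.
Let t23 : acts p t X23 1 := one_param_acts p_gt0 J23.
Let s23 : acts p s X23 (- 1)%R.
Proof.
rewrite -[s]invgK; apply: acts_inv => //; apply: (acts_from1 p_gt0 D23 t23).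
  exact/commute_sym/commuteV/commute_sym.
by rewrite E23 (relJV (rel_23s rel)) expr1z (zhomMn _ D23) // E23.
Qed.
Let t34 : acts p t X34 (- 1)%R.
Proof. by rewrite -[t]invgK; apply: acts_inv => //; apply: (one_param_acts p_gt0 J34). Qed.
Let s34 : acts p s X34 0.
Proof.
apply: (acts_fix D34 (one_param_acts p_gt0 J34)); first exact: commuteV.
by rewrite E34; exact: rel_34s rel.
Qed.
Let t13 : acts p t X13 1 := one_param_acts p_gt0 J13.
Let s13 : acts p s X13 0.
Proof. by apply: (acts_fix D13 t13) => //; rewrite E13; exact: rel_13s rel. Qed.
Let s24 : acts p s X24 (- 1)%R.
Proof. by rewrite -[s]invgK; apply: acts_inv => //; apply: (one_param_acts p_gt0 J24). Qed.
Let t24 : acts p t X24 0.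
Proof.
apply: (acts_fix D24 (one_param_acts p_gt0 J24)); first exact/commuteV/commute_sym.
by rewrite E24; exact: rel_24t rel.
Qed.

(* The weights of (s, t) are (1,0) on X12, (-1,1) on X23, (0,-1) on X34, (0,1) on
   X13 and (-1,0) on X24. For each of the eight pairs below, s, t, st and their
   inverses provide an element of weights (1,0) and one of weights (0,1). *)
Let am := acts_mul p_gt0.
Let ai (g : G) X e (h : acts p g X e) := acts_inv p_gt0 h.
Let tV12 := ai t12. Let sV23 := ai s23. Let tV23 := ai t23.
Let sV34 := ai s34. Let tV34 := ai t34. Let sV13 := ai s13. Let tV13 := ai t13.
Let sV24 := ai s24. Let tV24 := ai t24.

Let c12_34 : {in zp &, forall a b, commute (X12 a) (X34 b)}.
Proof.
apply: (zhom_centralise p_gt0 D12 D34 s12 s34 tV12 tV34).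
by rewrite E12 E34; exact: rel_12_34 rel.
Qed.
Let c12_13 : {in zp &, forall a b, commute (X12 a) (X13 b)}.
Proof.
apply: (zhom_centralise p_gt0 D12 D13 s12 s13 t12 t13).
by rewrite E12 E13; exact: rel_12_13 rel.
Qed.
Let c23_13 : {in zp &, forall a b, commute (X23 a) (X13 b)}.
Proof.
apply: (zhom_centralise p_gt0 D23 D13 sV23 sV13 (am s23 t23) (am s13 t13)).
by rewrite E23 E13; exact: rel_23_13 rel.
Qed.
Let c23_24 : {in zp &, forall a b, commute (X23 a) (X24 b)}.
Proof.
apply: (zhom_centralise p_gt0 D23 D24 t23 t24 (am sV23 tV23) (am sV24 tV24)).
by rewrite E23 E24; exact: rel_23_24 rel.
Qed.
Let c34_24 : {in zp &, forall a b, commute (X34 a) (X24 b)}.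
Proof.
apply: (zhom_centralise p_gt0 D34 D24 tV34 tV24 sV34 sV24).
by rewrite E34 E24; exact: rel_34_24 rel.
Qed.
Let c13_24 : {in zp &, forall a b, commute (X13 a) (X24 b)}.
Proof.
apply: (zhom_centralise p_gt0 D13 D24 t13 t24 sV13 sV24).
by rewrite E13 E24; exact: rel_13_24 rel.
Qed.

Let sym (X Y : rat -> G) : {in zp &, forall a b, commute (X a) (Y b)} ->
  {in zp &, forall a b, commute (Y a) (X b) :> Prop}.
Proof. by move=> c a b za zb; apply/commute_sym/c. Qed.

Let c12_23 : {in zp &, forall a b, X12 a * X23 b = X13 (a * b)%R * (X23 b * X12 a)}.
Proof.
apply: (zhom_bilinear p_gt0 D12 D23 D13 (sym c12_13) (sym c23_13)
  (am s12 t12) (am s23 t23) (am s13 t13) t12 t23 t13).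
by rewrite E12 E23 E13; exact: rel_12_23 rel.
Qed.
Let c23_34 : {in zp &, forall a b, X23 a * X34 b = X24 (a * b)%R * (X34 b * X23 a)}.
Proof.
apply: (zhom_bilinear p_gt0 D23 D34 D24 (sym c23_24) (sym c34_24)
  sV23 sV34 sV24 (am sV23 tV23) (am sV34 tV34) (am sV24 tV24)).
by rewrite E23 E34 E24; exact: rel_23_34 rel.
Qed.

(** ** The central one-parameter subgroup *)

Let W a b := X13 a * X34 b / X13 a / X34 b.

Let WE a b : X13 a * X34 b = W a b * (X34 b * X13 a).
Proof. by rewrite /W !mulgA !mulgVK. Qed.

Let W_commute a b y :
  commute y (X13 a) -> commute y (X34 b) -> commute y (W a b).
Proof. by move=> c13 c34; do !apply: commuteM => //; apply: commuteV. Qed.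

(** Write X12 X23 X34 in reverse order in two ways, starting with either pair of
    neighbours: a Hall-Witt identity in which all other commutators vanish. *)
Let hall_witt a b c : a \in zp -> b \in zp -> c \in zp ->
  X12 a * X24 (b * c)%R = W (a * b)%R c * (X24 (b * c)%R * X12 a).
Proof.
move=> za zb zc; have zab := rpredM za zb; have zbc := rpredM zb zc.
have WX24 : commute (X24 (b * c)%R) (W (a * b)%R c).
  by apply: W_commute; apply/commute_sym; [apply: c13_24 | apply: c34_24].
apply: (mulIg (X34 c * X23 b)).
transitivity (X13 (a * b)%R * X24 (b * c)%R * (X34 c * (X23 b * X12 a))).
  rewrite -mulgA -c23_34 // mulgA c12_23 // -!mulgA c12_34 //.
  by rewrite (mulgA (X23 b)) c23_34 // -!mulgA.
rewrite -!mulgA (mulgA (X12 a)) c12_34 // -(mulgA (X34 c)) c12_23 //.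
rewrite !mulgA -WX24 c13_24 // -!mulgA; congr (_ * _).
by rewrite mulgA WE -!mulgA.
Qed.

Let W_mul a b : a \in zp -> b \in zp -> W a b = W (a * b)%R 1%R.
Proof.
move=> za zb; have zab := rpredM za zb.
apply: (mulIg (X24 b * X12 a)); have := hall_witt za zb zp1.
by rewrite mulr1 => <-; have := hall_witt za zp1 zb; rewrite mulr1 mul1r => ->.
Qed.

(** The function is locked: otherwise rewriting would see through the values of
    X14 and regroup their factors. *)
Definition abels_centre a := locked (W a 1%R).
Let X14 := abels_centre.

Let X14W a : X14 a = W a 1%R. Proof. by rewrite /X14 /abels_centre -lock. Qed.

Let c12_24 : {in zp &, forall a b, X12 a * X24 b = X14 (a * b)%R * (X24 b * X12 a)}.
Proof. by move=> a b za zb; have := hall_witt za zb zp1; rewrite mulr1 -X14W. Qed.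
Let c13_34 : {in zp &, forall a b, X13 a * X34 b = X14 (a * b)%R * (X34 b * X13 a)}.
Proof. by move=> a b za zb; rewrite WE W_mul // -X14W. Qed.

Let X14E a : a \in zp -> X14 a = X12 a * X24 1%R / X12 a / X24 1%R.
Proof. by move=> za; rewrite c12_24 // mulr1 !mulgA !mulgK. Qed.

Let X14_commute a y : a \in zp ->
  commute y (X12 a) -> commute y (X24 1%R) -> commute y (X14 a).
Proof.
by move=> za c12 c24; rewrite X14E //; do !apply: commuteM => //; apply: commuteV.
Qed.

Let c14_12 : {in zp &, forall a b, commute (X14 a) (X12 b)}.
Proof.
move=> a b za zb; rewrite X14W; apply/commute_sym/W_commute.
  exact: c12_13.
exact: c12_34.
Qed.
Let c14_24 : {in zp &, forall a b, commute (X14 a) (X24 b)}.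
Proof.
move=> a b za zb; rewrite X14W; apply/commute_sym/W_commute; apply/commute_sym.
  exact: c13_24.
exact: c34_24.
Qed.
Let c14_13 : {in zp &, forall a b, commute (X14 a) (X13 b)}.
Proof.
move=> a b za zb; apply/commute_sym/X14_commute => //; last exact: c13_24.
exact/commute_sym/c12_13.
Qed.
Let c14_34 : {in zp &, forall a b, commute (X14 a) (X34 b)}.
Proof.
move=> a b za zb; apply/commute_sym/X14_commute => //; last exact: c34_24.
exact/commute_sym/c12_34.
Qed.
(* Conjugation by X23 b multiplies X12 a by a value of X13, which commutes with
   X24; hence it fixes X14 a, the commutator of X12 a and X24 1. *)
Let c14_23 : {in zp &, forall a b, commute (X14 a) (X23 b)}.
Proof.
move=> a b za zb; have zab := rpredM za zb.
apply: (mulIg (X24 1%R * X12 a)).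
have E : X14 a * (X24 1%R * X12 a) = X12 a * X24 1%R by rewrite c12_24 // mulr1.
have V : X23 b * X12 a = (X13 (a * b)%R)^-1 * (X12 a * X23 b).
  by rewrite c12_23 // mulKg.
transitivity (X14 a * (X24 1%R * ((X13 (a * b)%R)^-1 * (X12 a * X23 b)))).
  by rewrite -V -mulgA; congr (_ * _); rewrite !mulgA c23_24.
transitivity ((X13 (a * b)%R)^-1 * (X14 a * (X24 1%R * X12 a) * X23 b)).
  rewrite (mulgA (X24 _)) (commuteV (commute_sym (c13_24 zab zp1))).
  by rewrite !mulgA (commuteV (c14_13 za zab)).
by rewrite -[RHS]mulgA E -mulgA -c23_24 // !mulgA V !mulgA.
Qed.

Let D14 : zhom p X14.
Proof.
move=> a b za zb; apply: (mulIg (X24 1%R * X12 (b + a)%R)).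
rewrite -{1}[(a + b)%R]mulr1 [in X14 _]addrC -c12_24 ?rpredD // D12 // -mulgA c12_24 //.
rewrite mulr1 (mulgA (X12 b)) -c14_12 // -!mulgA (mulgA (X12 b)) c12_24 // mulr1.
by rewrite -!mulgA.
Qed.

(* On X14 a, seen as the commutator of X12 a and X24 1, the weights of s cancel;
   for t, the same holds with X13 and X34. *)
Let s14 : acts p s X14 0.
Proof.
move=> a za; have zpa e : (p%:R ^ e * a)%R \in zp by rewrite rpredM ?zinv_expz.
have zp' e : ((p%:R : rat) ^ e)%R \in zp by rewrite zinv_expz.
have E : (X12 a * X24 1%R) ^ s = (X14 a * (X24 1%R * X12 a)) ^ s.
  by rewrite c12_24 // mulr1.
rewrite mul1r; move: E; rewrite !conjMg s12 // s24 // mulr1 c12_24 //.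
move/mulIg=> <-; congr (X14 _).
by rewrite mulrAC -expfzDr ?pR_neq0 // subrr mul1r.
Qed.
Let t14 : acts p t X14 0.
Proof.
move=> a za; have zpa e : (p%:R ^ e * a)%R \in zp by rewrite rpredM ?zinv_expz.
have zp' e : ((p%:R : rat) ^ e)%R \in zp by rewrite zinv_expz.
have E : (X13 a * X34 1%R) ^ t = (X14 a * (X34 1%R * X13 a)) ^ t.
  by rewrite c13_34 // mulr1.
rewrite mul1r; move: E; rewrite !conjMg t13 // t34 // mulr1 c13_34 //.
move/mulIg=> <-; congr (X14 _).
by rewrite mulrAC -expfzDr ?pR_neq0 // subrr mul1r.
Qed.

(** ** Normal forms *)

(** The columns of a unipotent matrix, last column first, times an element of the
    torus: in this order, the product of the matrices of the columns has
    exactly the off-diagonal entries a_ij, and each of these matrices is a product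
    of commuting root elements. *)
Definition normal_form (k l : int) a12 a13 a14 a23 a24 a34 : G :=
  X14 a14 * (X24 a24 * (X34 a34 * (X13 a13 * (X23 a23 * (X12 a12 *
    (gexpz s k * gexpz t l)))))).

Lemma normal_form1 : normal_form 0 0 0 0 0 0 0 0 = 1.
Proof.
rewrite /normal_form (zhom0 D14) (zhom0 D24) (zhom0 D34) (zhom0 D13).
by rewrite (zhom0 D23) (zhom0 D12) /= !mul1g.
Qed.

Section LeftMultiplication.
Variables (k l : int) (a12 a13 a14 a23 a24 a34 : rat).
Hypotheses (z12 : a12 \in zp) (z13 : a13 \in zp) (z14 : a14 \in zp).
Hypotheses (z23 : a23 \in zp) (z24 : a24 \in zp) (z34 : a34 \in zp).
Local Notation NF := (normal_form k l a12 a13 a14 a23 a24 a34).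

Let act_left (g : G) X e a h : acts p g X e -> a \in zp ->
  g * (X a * h) = X (p%:R ^ (- e) * a)%R * (g * h).
Proof.
move=> gX za; rewrite -(acts_inv p_gt0 gX) // conjgE invgK.
by rewrite !mulgA mulgVK.
Qed.

Lemma normal_form_s : s * NF = normal_form (1 + k) l
  (a12 / p%:R)%R a13 a14 (a23 * p%:R)%R (a24 * p%:R)%R a34.
Proof.
rewrite /normal_form (act_left _ s14) // (act_left _ s24) // (act_left _ s34) //.
rewrite (act_left _ s13) // (act_left _ s23) // (act_left _ s12) // (mulgA s (gexpz s k)) gexpzS.
by rewrite oppr0 opprK !mul1r expr1z exprN1 ![(_ * p%:R)%R]mulrC [(_ / _)%R]mulrC.
Qed.

Lemma normal_form_t : t * NF = normal_form k (1 + l)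
  a12 (a13 / p%:R)%R a14 (a23 / p%:R)%R a24 (a34 * p%:R)%R.
Proof.
rewrite /normal_form (act_left _ t14) // (act_left _ t24) // (act_left _ t34) //.
rewrite (act_left _ t13) // (act_left _ t23) // (act_left _ t12) //.
have E : t * (gexpz s k * gexpz t l) = gexpz s k * gexpz t (1 + l)%R.
  rewrite -gexpzS !mulgA; congr (_ * _); apply/esym/commute_sym.
  by case: (k) => n; do ?apply: commuteV; apply: commuteX; apply: commute_sym.
by rewrite E oppr0 opprK !mul1r expr1z exprN1 ![(_ * p%:R)%R]mulrC ![(_ / _)%R]mulrC.
Qed.

Lemma normal_form_x12 : x12 * NF = normal_form k l
  (1 + a12)%R (a23 + a13)%R (a24 + a14)%R a23 a24 a34.
Proof.
rewrite /normal_form -E12 mulgA -c14_12 // -mulgA (mulgA _ (X24 _)) c12_24 // mul1r.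
rewrite -!mulgA (mulgA _ (X34 _)) c12_34 // -!mulgA (mulgA _ (X13 _)) c12_13 //.
rewrite -!mulgA (mulgA _ (X23 _)) c12_23 // mul1r -!mulgA (mulgA (X12 1%R)) -D12 //.
by rewrite (addrC a24) (addrC a23) D14 // D13 // -!mulgA.
Qed.

Lemma normal_form_x23 : x23 * NF = normal_form k l
  a12 a13 a14 (1 + a23)%R (a34 + a24)%R a34.
Proof.
rewrite /normal_form -E23 mulgA -c14_23 // -mulgA (mulgA _ (X24 _)) c23_24 //.
rewrite -!mulgA (mulgA _ (X34 _)) c23_34 // mul1r -!mulgA (mulgA _ (X13 _)) c23_13 //.
rewrite -!mulgA (mulgA (X23 1%R)) -D23 //.
by rewrite (addrC a34) D24 // -!mulgA.
Qed.

Lemma normal_form_x34 : x34 * NF = normal_form k l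
  a12 a13 a14 a23 a24 (1 + a34)%R.
Proof.
rewrite /normal_form -E34 mulgA -c14_34 // -mulgA (mulgA _ (X24 _)) c34_24 //.
by rewrite -!mulgA (mulgA (X34 1%R)) -D34.
Qed.

Lemma normal_form_x13 : x13 * NF = normal_form k l
  a12 (1 + a13)%R (a34 + a14)%R a23 a24 a34.
Proof.
rewrite /normal_form -E13 mulgA -c14_13 // -mulgA (mulgA _ (X24 _)) c13_24 //.
rewrite -!mulgA (mulgA _ (X34 _)) c13_34 // mul1r -!mulgA (mulgA (X13 1%R)) -D13 //.
by rewrite (mulgA (X24 _) (X14 _)) -c14_24 // -!mulgA (addrC a34) D14 // -!mulgA.
Qed.

Lemma normal_form_x24 : x24 * NF = normal_form k l
  a12 a13 a14 a23 (1 + a24)%R a34.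
Proof.
by rewrite /normal_form -E24 mulgA -c14_24 // -mulgA (mulgA (X24 1%R)) -D24.
Qed.

End LeftMultiplication.

End AbelsRelations.

(** * Entries of the matrices of Abels' group *)

Lemma sum4 (F : 'I_4 -> rat) : \sum_i F i = F 0 + F 1 + F 2 + F 3.
Proof.
rewrite !big_ord_recl big_ord0 addr0 !addrA.
by congr (F _ + F _ + F _ + F _); apply: val_inj.
Qed.

Lemma ord4P (P : 'I_4 -> Prop) : P 0 -> P 1 -> P 2 -> P 3 -> forall i, P i.
Proof.
move=> P0 P1 P2 P3 [[|[|[|[|//]]]] i4].
- by rewrite (_ : Ordinal _ = 0) //; apply/val_inj.
- by rewrite (_ : Ordinal _ = 1) //; apply/val_inj.
- by rewrite (_ : Ordinal _ = 2) //; apply/val_inj.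
- by rewrite (_ : Ordinal _ = 3) //; apply/val_inj.
Qed.

Section Entries.
Variables (p : nat) (p_pr : prime p).
Local Notation H := (abels p_pr).
Implicit Types (A B : H) (k l : int).

Let p_gt0 : (0 < p)%N := prime_gt0 p_pr.
Let pn0 : p%:R != 0 :> rat := pR_neq0 p_gt0.

Definition ent A (i j : 'I_4) : rat := (val A : 'M[rat]_4) i j.

Let entl A (i j : 'I_4) : (j < i)%N -> ent A i j = 0.
Proof. by move=> ji; case/abels_mxP: (valP A) => _ /(_ i j ji). Qed.

Let ent00 A : ent A 0 0 = 1. Proof. by case/abels_mxP: (valP A) => _ _ []. Qed.
Let ent33 A : ent A 3 3 = 1. Proof. by case/abels_mxP: (valP A) => _ _ []. Qed.

Lemma ent_zinv A i j : ent A i j \in zinv p.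
Proof. by have [Az _ _ _ _] := abels_mxP _ _ (valP A); apply: Az. Qed.

Lemma ent11_power A : exists k, ent A 1 1 = p%:R ^ k.
Proof. by have [_ _ _ /asboolP] := abels_mxP _ _ (valP A). Qed.

Lemma ent22_power A : exists k, ent A 2 2 = p%:R ^ k.
Proof. by have [_ _ _ _ /asboolP] := abels_mxP _ _ (valP A). Qed.

Lemma ent11_gt0 A : 0 < ent A 1 1.
Proof. by have [k ->] := ent11_power A; rewrite exprz_gt0 // ltr0n. Qed.

Lemma ent22_gt0 A : 0 < ent A 2 2.
Proof. by have [k ->] := ent22_power A; rewrite exprz_gt0 // ltr0n. Qed.

Lemma entP A B :
  [/\ ent A 1 1 = ent B 1 1, ent A 2 2 = ent B 2 2, ent A 0 1 = ent B 0 1,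
      ent A 0 2 = ent B 0 2 & ent A 0 3 = ent B 0 3] ->
  [/\ ent A 1 2 = ent B 1 2, ent A 1 3 = ent B 1 3 & ent A 2 3 = ent B 2 3] ->
  A = B.
Proof.
move=> [? ? ? ? ?] [? ? ?]; apply/val_inj/matrixP => i j.
rewrite -[LHS]/(ent A i j) -[RHS]/(ent B i j).
by move: j; apply: ord4P; move: i; apply: ord4P; rewrite ?ent00 ?ent33 // !entl.
Qed.

Let entME A B i j : ent (A * B)%g i j =
  ent A i 0 * ent B 0 j + ent A i 1 * ent B 1 j + ent A i 2 * ent B 2 j + ent A i 3 * ent B 3 j.
Proof. by rewrite /ent (_ : val (A * B)%g = val A *m val B) ?mxE ?sum4. Qed.

Let entM11 A B : ent (A * B)%g 1 1 = ent A 1 1 * ent B 1 1.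
Proof. by rewrite entME (@entl A 1 0) // (@entl B 2 1) // (@entl B 3 1) //; ring. Qed.
Let entM22 A B : ent (A * B)%g 2 2 = ent A 2 2 * ent B 2 2.
Proof. by rewrite entME (@entl A 2 0) // (@entl A 2 1) // (@entl B 3 2) //; ring. Qed.
Let entM01 A B : ent (A * B)%g 0 1 = ent B 0 1 + ent A 0 1 * ent B 1 1.
Proof. by rewrite entME ent00 (@entl B 2 1) // (@entl B 3 1) //; ring. Qed.
Let entM12 A B : ent (A * B)%g 1 2 = ent A 1 1 * ent B 1 2 + ent A 1 2 * ent B 2 2.
Proof. by rewrite entME (@entl A 1 0) // (@entl B 3 2) //; ring. Qed.
Let entM23 A B : ent (A * B)%g 2 3 = ent A 2 2 * ent B 2 3 + ent A 2 3.
Proof. by rewrite entME (@entl A 2 0) // (@entl A 2 1) // ent33; ring. Qed.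
Let entM02 A B : ent (A * B)%g 0 2 =
  ent B 0 2 + ent A 0 1 * ent B 1 2 + ent A 0 2 * ent B 2 2.
Proof. by rewrite entME ent00 (@entl B 3 2) //; ring. Qed.
Let entM13 A B : ent (A * B)%g 1 3 =
  ent A 1 1 * ent B 1 3 + ent A 1 2 * ent B 2 3 + ent A 1 3.
Proof. by rewrite entME (@entl A 1 0) // ent33; ring. Qed.
Let entM03 A B : ent (A * B)%g 0 3 =
  ent B 0 3 + ent A 0 1 * ent B 1 3 + ent A 0 2 * ent B 2 3 + ent A 0 3.
Proof. by rewrite entME ent00 ent33; ring. Qed.

Definition entM := (entM11, entM22, entM01, entM12, entM23, entM02, entM13, entM03).

Let ent1_ (i j : 'I_4) : ent 1%g i j = (i == j)%:R.
Proof. by rewrite /ent (_ : val (1%g : H) = 1%:M) ?mxE. Qed.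

Definition ent1 : (ent 1%g 1 1 = 1) * (ent 1%g 2 2 = 1) * (ent 1%g 0 1 = 0) *
  (ent 1%g 1 2 = 0) * (ent 1%g 2 3 = 0) * (ent 1%g 0 2 = 0) * (ent 1%g 1 3 = 0) *
  (ent 1%g 0 3 = 0).
Proof. by rewrite !ent1_. Qed.

(** ** Matrices with given entries *)

Definition upper4 (a11 a22 a01 a02 a03 a12 a13 a23 : rat) : 'M[rat]_4 :=
  \matrix_(i < 4, j < 4) nth 0 (nth [::]
    [:: [:: 1; a01; a02; a03]; [:: 0; a11; a12; a13]; [:: 0; 0; a22; a23]; [:: 0; 0; 0; 1]] i) j.

Section AbelsOf.
Variables (k l : int) (a01 a02 a03 a12 a13 a23 : Zinv p).

Let M : 'M[rat]_4 := upper4 (p%:R ^ k) (p%:R ^ l)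
  (val a01) (val a02) (val a03) (val a12) (val a13) (val a23).

Let abels_of_subproof : M \in abels_mx p.
Proof.
have z0 : 0 \in zinv p := rpred0 _.
have z1 : 1 \in zinv p := rpred1 _.
have zv (a : Zinv p) : val a \in zinv p := valP a.
apply/abels_mxP; split; rewrite ?mxE //=.
- by apply: ord4P; apply: ord4P; rewrite mxE //= ?zinv_expz ?zv.
- by apply: ord4P; apply: ord4P; rewrite // mxE.
- by apply/asboolP; exists k.
- by apply/asboolP; exists l.
Qed.

Definition abels_of : H := Sub M abels_of_subproof.

Lemma ent_of : (ent abels_of 1 1 = p%:R ^ k) * (ent abels_of 2 2 = p%:R ^ l) *
  (ent abels_of 0 1 = val a01) * (ent abels_of 0 2 = val a02) *
  (ent abels_of 0 3 = val a03) * (ent abels_of 1 2 = val a12) *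
  (ent abels_of 1 3 = val a13) * (ent abels_of 2 3 = val a23).
Proof. by rewrite /ent (_ : val abels_of = M) ?mxE. Qed.

End AbelsOf.

(** Rows and columns are numbered from 0, as the entries of matrices are, while the
    names of the relations number them from 1: E01 is the root subgroup X12. *)
Definition dS : H := abels_of 1 0 0 0 0 0 0 0.
Definition dT : H := abels_of 0 1 0 0 0 0 0 0.
Definition E01 a : H := abels_of 0 0 a 0 0 0 0 0.
Definition E02 a : H := abels_of 0 0 0 a 0 0 0 0.
Definition E03 a : H := abels_of 0 0 0 0 a 0 0 0.
Definition E12 a : H := abels_of 0 0 0 0 0 a 0 0.
Definition E13 a : H := abels_of 0 0 0 0 0 0 a 0.
Definition E23 a : H := abels_of 0 0 0 0 0 0 0 a.

Let v0 : val (0 : Zinv p) = 0. Proof. exact: rmorph0. Qed.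
Let v1 : val (1 : Zinv p) = 1. Proof. exact: rmorph1. Qed.
Let vD (a b : Zinv p) : val (a + b) = val a + val b. Proof. exact: rmorphD. Qed.

Lemma E01D : {morph E01 : a b / a + b >-> (a * b)%g}.
Proof. by move=> a b; apply: entP; split; rewrite !(entM, ent_of, v0, vD) ?expr0z; ring. Qed.
Lemma E02D : {morph E02 : a b / a + b >-> (a * b)%g}.
Proof. by move=> a b; apply: entP; split; rewrite !(entM, ent_of, v0, vD) ?expr0z; ring. Qed.
Lemma E03D : {morph E03 : a b / a + b >-> (a * b)%g}.
Proof. by move=> a b; apply: entP; split; rewrite !(entM, ent_of, v0, vD) ?expr0z; ring. Qed.
Lemma E12D : {morph E12 : a b / a + b >-> (a * b)%g}.
Proof. by move=> a b; apply: entP; split; rewrite !(entM, ent_of, v0, vD) ?expr0z; ring. Qed.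
Lemma E13D : {morph E13 : a b / a + b >-> (a * b)%g}.
Proof. by move=> a b; apply: entP; split; rewrite !(entM, ent_of, v0, vD) ?expr0z; ring. Qed.
Lemma E23D : {morph E23 : a b / a + b >-> (a * b)%g}.
Proof. by move=> a b; apply: entP; split; rewrite !(entM, ent_of, v0, vD) ?expr0z; ring. Qed.

Lemma ent_dS : (ent dS 1 1 = p%:R) * (ent dS 2 2 = 1) * (ent dS 0 1 = 0) *
  (ent dS 0 2 = 0) * (ent dS 0 3 = 0) * (ent dS 1 2 = 0) * (ent dS 1 3 = 0) * (ent dS 2 3 = 0).
Proof. by rewrite !ent_of !v0 expr0z expr1z. Qed.
Lemma ent_dT : (ent dT 1 1 = 1) * (ent dT 2 2 = p%:R) * (ent dT 0 1 = 0) *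
  (ent dT 0 2 = 0) * (ent dT 0 3 = 0) * (ent dT 1 2 = 0) * (ent dT 1 3 = 0) * (ent dT 2 3 = 0).
Proof. by rewrite !ent_of !v0 expr0z expr1z. Qed.

Section EntriesOfElementary.
Variable a : Zinv p.
Lemma ent_E01 : (ent (E01 a) 1 1 = 1) * (ent (E01 a) 2 2 = 1) * (ent (E01 a) 0 1 = val a) *
  (ent (E01 a) 0 2 = 0) * (ent (E01 a) 0 3 = 0) * (ent (E01 a) 1 2 = 0) *
  (ent (E01 a) 1 3 = 0) * (ent (E01 a) 2 3 = 0).
Proof. by rewrite !ent_of !v0 expr0z. Qed.
Lemma ent_E02 : (ent (E02 a) 1 1 = 1) * (ent (E02 a) 2 2 = 1) * (ent (E02 a) 0 1 = 0) *
  (ent (E02 a) 0 2 = val a) * (ent (E02 a) 0 3 = 0) * (ent (E02 a) 1 2 = 0) *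
  (ent (E02 a) 1 3 = 0) * (ent (E02 a) 2 3 = 0).
Proof. by rewrite !ent_of !v0 expr0z. Qed.
Lemma ent_E03 : (ent (E03 a) 1 1 = 1) * (ent (E03 a) 2 2 = 1) * (ent (E03 a) 0 1 = 0) *
  (ent (E03 a) 0 2 = 0) * (ent (E03 a) 0 3 = val a) * (ent (E03 a) 1 2 = 0) *
  (ent (E03 a) 1 3 = 0) * (ent (E03 a) 2 3 = 0).
Proof. by rewrite !ent_of !v0 expr0z. Qed.
Lemma ent_E12 : (ent (E12 a) 1 1 = 1) * (ent (E12 a) 2 2 = 1) * (ent (E12 a) 0 1 = 0) *
  (ent (E12 a) 0 2 = 0) * (ent (E12 a) 0 3 = 0) * (ent (E12 a) 1 2 = val a) *
  (ent (E12 a) 1 3 = 0) * (ent (E12 a) 2 3 = 0).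
Proof. by rewrite !ent_of !v0 expr0z. Qed.
Lemma ent_E13 : (ent (E13 a) 1 1 = 1) * (ent (E13 a) 2 2 = 1) * (ent (E13 a) 0 1 = 0) *
  (ent (E13 a) 0 2 = 0) * (ent (E13 a) 0 3 = 0) * (ent (E13 a) 1 2 = 0) *
  (ent (E13 a) 1 3 = val a) * (ent (E13 a) 2 3 = 0).
Proof. by rewrite !ent_of !v0 expr0z. Qed.
Lemma ent_E23 : (ent (E23 a) 1 1 = 1) * (ent (E23 a) 2 2 = 1) * (ent (E23 a) 0 1 = 0) *
  (ent (E23 a) 0 2 = 0) * (ent (E23 a) 0 3 = 0) * (ent (E23 a) 1 2 = 0) *
  (ent (E23 a) 1 3 = 0) * (ent (E23 a) 2 3 = val a).
Proof. by rewrite !ent_of !v0 expr0z. Qed.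
End EntriesOfElementary.

Definition entE := (ent_dS, ent_dT, ent_E01, ent_E02, ent_E03, ent_E12, ent_E13, ent_E23).

Lemma abels_rel_abels : abels_rel p dS dT (E01 1) (E12 1) (E23 1) (E02 1) (E13 1).
Proof.
(* Only the value of 1 matters; an opaque u keeps the entries from unfolding. *)
move: v1; move: (1 : Zinv p) => u u1.
have vX : val (u *+ p) = p%:R by rewrite raddfMn /= u1.
by split; rewrite -?(add_morphX E01D) -?(add_morphX E02D)
  -?(add_morphX E12D) -?(add_morphX E13D) -?(add_morphX E23D);
  apply: entP; split; rewrite !(entM, entE) ?vX ?u1; ring.
Qed.

End Entries.

(** * Abels' presentation *)

Section AbelsWords.
Variable p : nat.

Definition abels_letter (i : nat) : letter 7 := (inord i, false).
Local Notation s := (abels_letter 0).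
Local Notation t := (abels_letter 1).
Local Notation x12 := (abels_letter 2).
Local Notation x23 := (abels_letter 3).
Local Notation x34 := (abels_letter 4).
Local Notation x13 := (abels_letter 5).
Local Notation x24 := (abels_letter 6).

Definition abels_equations : seq (word 7 * word 7) :=
  [:: ([:: s; t], [:: t; s]);
      ([:: x12; s], s :: nseq p x12); ([:: x12; t], [:: t; x12]);
      ([:: s; x23], rcons (nseq p x23) s); ([:: x23; t], t :: nseq p x23);
      ([:: x34; s], [:: s; x34]); ([:: t; x34], rcons (nseq p x34) t);
      ([:: x13; s], [:: s; x13]); ([:: x13; t], t :: nseq p x13);
      ([:: s; x24], rcons (nseq p x24) s); ([:: x24; t], [:: t; x24]);
      ([:: x12; x34], [:: x34; x12]); ([:: x12; x13], [:: x13; x12]);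
      ([:: x23; x13], [:: x13; x23]); ([:: x23; x24], [:: x24; x23]);
      ([:: x34; x24], [:: x24; x34]); ([:: x13; x24], [:: x24; x13]);
      ([:: x12; x23], [:: x13; x23; x12]); ([:: x23; x34], [:: x24; x34; x23])].

Definition abels_relators : seq (word 7) :=
  [seq e.1 ++ inv_word e.2 | e <- abels_equations].

Lemma abels_relatorsP (G : groupType) (x : 'I_7 -> G) :
  (forall r, r \in abels_relators -> eval_word x r = 1%g) <->
  abels_rel p (x (inord 0)) (x (inord 1)) (x (inord 2)) (x (inord 3))
              (x (inord 4)) (x (inord 5)) (x (inord 6)).
Proof.
have -> : (forall r, r \in abels_relators -> eval_word x r = 1%g) <->
    all (fun e => eval_word x e.1 == eval_word x e.2) abels_equations.
  split=> [E | /allP E r /mapP[e /E/eqP e12 ->]].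
    apply/allP=> e eE; apply/eqP/divg1_eq.
    by rewrite -eval_word_inv -eval_word_cat; apply/E/mapP; exists e.
  by rewrite eval_word_cat eval_word_inv e12 mulgV.
rewrite /= -!cats1 !(eval_word_cons, eval_word_cat, eval_word_nseq, eval_word_nil).
rewrite /eval_letter /= !mulg1.
split; first by do 19 ![case/andP=> /eqP ?].
by case; do 19 ![move=> ->; rewrite eqxx].
Qed.

End AbelsWords.

Section NormalFormOfMatrix.
Variables (p : nat) (p_pr : prime p).
Local Notation H := (abels p_pr).

Let p_gt0 : (0 < p)%N := prime_gt0 p_pr.
Let pn0 : p%:R != 0 :> rat := pR_neq0 p_gt0.

(** ** Every element of Abels' group has a normal form *)

Definition plog (x : rat) : int :=
  if pselect (exists k, x = p%:R ^ k) is left h then projT1 (cid h) else 0.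

Lemma plogK x : (exists k, x = p%:R ^ k) -> p%:R ^ plog x = x.
Proof. by rewrite /plog; case: pselect => // h _; case: (cid h). Qed.

Lemma plog_expz k : plog (p%:R ^ k) = k.
Proof.
have : p%:R ^ plog (p%:R ^ k) = p%:R ^ k :> rat by apply: plogK; exists k.
apply: ieexprIz; rewrite ?ltr0n // pnatr_eq1.
by rewrite neq_ltn prime_gt1 ?orbT.
Qed.

Variables (G : groupType) (s t x12 x23 x34 x13 x24 : G).
Hypothesis rel : abels_rel p s t x12 x23 x34 x13 x24.

(** A is a unipotent matrix times its diagonal, so the entries of the unipotent
    factor are those of A divided by the diagonal entry of their column. *)
Definition matrix_form (A : H) : G :=
  normal_form p s t x12 x23 x34 x13 x24 (plog (ent A 1 1)) (plog (ent A 2 2))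
    (ent A 0 1 / ent A 1 1) (ent A 0 2 / ent A 2 2) (ent A 0 3)
    (ent A 1 2 / ent A 2 2) (ent A 1 3) (ent A 2 3).

Lemma matrix_form1 : matrix_form 1%g = 1%g.
Proof.
rewrite /matrix_form !ent1 !mul0r -[in plog _](expr0z p%:R) plog_expz.
exact: (normal_form1 p_gt0 rel).
Qed.

Lemma plogM (x : rat) : (exists k, x = p%:R ^ k) -> plog (p%:R * x) = 1 + plog x.
Proof. by case=> k ->; rewrite -{1}(expr1z p%:R) -expfzDr // !plog_expz. Qed.

Let e11 (A : H) : ent A 1 1 != 0 := lt0r_neq0 (ent11_gt0 A).
Let e22 (A : H) : ent A 2 2 != 0 := lt0r_neq0 (ent22_gt0 A).

Let z11 (A : H) x : x \in zinv p -> x / ent A 1 1 \in zinv p.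
Proof. by move=> zx; have [k ->] := ent11_power A; rewrite invr_expz rpredM ?zinv_expz. Qed.
Let z22 (A : H) x : x \in zinv p -> x / ent A 2 2 \in zinv p.
Proof. by move=> zx; have [k ->] := ent22_power A; rewrite invr_expz rpredM ?zinv_expz. Qed.

Section Equivariance.
Variable A : H.

Lemma matrix_form_s : matrix_form (dS p_pr * A)%g = (s * matrix_form A)%g.
Proof.
rewrite /matrix_form (normal_form_s p_gt0 rel) ?z11 ?z22 ?ent_zinv //.
have nA := (e11 A, e22 A).
congr normal_form; rewrite !(entM, ent_dS) ?mul1r ?plogM //; try exact: ent11_power;
  by field; rewrite ?pn0 ?nA.
Qed.

Lemma matrix_form_t : matrix_form (dT p_pr * A)%g = (t * matrix_form A)%g.
Proof.
rewrite /matrix_form (normal_form_t p_gt0 rel) ?z11 ?z22 ?ent_zinv //.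
have nA := (e11 A, e22 A).
congr normal_form; rewrite !(entM, ent_dT) ?mul1r ?plogM //; try exact: ent22_power;
  by field; rewrite ?pn0 ?nA.
Qed.

Let val1 : val (1 : Zinv p) = 1. Proof. exact: rmorph1. Qed.

Lemma matrix_form_x12 : matrix_form (E01 p_pr 1%R * A)%g = (x12 * matrix_form A)%g.
Proof.
rewrite /matrix_form (normal_form_x12 p_gt0 rel) ?z11 ?z22 ?ent_zinv //.
have nA := (e11 A, e22 A).
congr normal_form; rewrite !(entM, ent_E01) ?val1 ?mul1r //;
  by field; rewrite ?nA.
Qed.

Lemma matrix_form_x23 : matrix_form (E12 p_pr 1%R * A)%g = (x23 * matrix_form A)%g.
Proof.
rewrite /matrix_form (normal_form_x23 p_gt0 rel) ?z11 ?z22 ?ent_zinv //.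
have nA := (e11 A, e22 A).
congr normal_form; rewrite !(entM, ent_E12) ?val1 ?mul1r //;
  by field; rewrite ?nA.
Qed.

Lemma matrix_form_x34 : matrix_form (E23 p_pr 1%R * A)%g = (x34 * matrix_form A)%g.
Proof.
rewrite /matrix_form (normal_form_x34 p_gt0 rel) ?z11 ?z22 ?ent_zinv //.
have nA := (e11 A, e22 A).
congr normal_form; rewrite !(entM, ent_E23) ?val1 ?mul1r //;
  by field; rewrite ?nA.
Qed.

Lemma matrix_form_x13 : matrix_form (E02 p_pr 1%R * A)%g = (x13 * matrix_form A)%g.
Proof.
rewrite /matrix_form (normal_form_x13 p_gt0 rel) ?z11 ?z22 ?ent_zinv //.
have nA := (e11 A, e22 A).
congr normal_form; rewrite !(entM, ent_E02) ?val1 ?mul1r //;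
  by field; rewrite ?nA.
Qed.

Lemma matrix_form_x24 : matrix_form (E13 p_pr 1%R * A)%g = (x24 * matrix_form A)%g.
Proof.
rewrite /matrix_form (normal_form_x24 p_gt0 rel) ?z11 ?z22 ?ent_zinv //.
have nA := (e11 A, e22 A).
congr normal_form; rewrite !(entM, ent_E13) ?val1 ?mul1r //;
  by field; rewrite ?nA.
Qed.

End Equivariance.

End NormalFormOfMatrix.

Section AbelsGroup.
Variables (p : nat) (p_pr : prime p).
Local Notation H := (abels p_pr).
Implicit Types A B : H.

Let p_gt0 : (0 < p)%N := prime_gt0 p_pr.
Let pn0 : p%:R != 0 :> rat := pR_neq0 p_gt0.
Let e11 A : ent A 1 1 != 0 := lt0r_neq0 (ent11_gt0 A).
Let e22 A : ent A 2 2 != 0 := lt0r_neq0 (ent22_gt0 A).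

Definition abels_gens (i : 'I_7) : H :=
  nth 1%g [:: dS p_pr; dT p_pr; E01 p_pr 1; E12 p_pr 1; E23 p_pr 1; E02 p_pr 1;
              E13 p_pr 1] i.

Lemma abels_gens_rel : abels_rel p (abels_gens (inord 0)) (abels_gens (inord 1))
  (abels_gens (inord 2)) (abels_gens (inord 3)) (abels_gens (inord 4))
  (abels_gens (inord 5)) (abels_gens (inord 6)).
Proof. by rewrite /abels_gens !inordK //=; apply: abels_rel_abels. Qed.

Section Generation.
Local Open Scope group_scope.

Let S (A : H) := exists w, eval_word abels_gens w = A.

Let S1 : S 1. Proof. by exists [::]; apply: eval_word_nil. Qed.
Let SM A B : S A -> S B -> S (A * B).
Proof. by move=> [u <-] [v <-]; exists (u ++ v); apply: eval_word_cat. Qed.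
Let SV A : S A -> S A^-1.
Proof. by move=> [u <-]; exists (inv_word u); apply: eval_word_inv. Qed.
Let SJ A B : S A -> S B -> S (A ^ B).
Proof. by move=> SA SB; apply: SM (SV SB) _; apply: SM. Qed.

Let Sgen (k : nat) : (k < 7)%N -> S (abels_gens (inord k)).
Proof.
by move=> k7; exists [:: (inord k, false)]; rewrite eval_word_cons eval_word_nil mulg1.
Qed.

Let SdS : S (dS p_pr).
Proof. by have := @Sgen 0 isT; rewrite /abels_gens inordK. Qed.
Let SdT : S (dT p_pr).
Proof. by have := @Sgen 1 isT; rewrite /abels_gens inordK. Qed.

(** Conjugating the element of parameter 1 by the powers of d reaches the
    parameters p^-k, which generate Z[1/p]. *)
Let S_root (E : Zinv p -> H) (d : H) :
  {morph E : a b / (a + b)%R >-> a * b} -> S d -> S (E 1%R) ->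
  (forall a b, val a = (p%:R * val b)%R -> E a = E b ^ d) ->
  forall a, S (E a).
Proof.
move=> ED Sd S1' EJ; apply: zinv_morph_ind => //.
elim=> [|k IHk] a ak.
  by rewrite (_ : a = 1%R) //; apply: val_inj; rewrite ak rmorph1 oppr0 expr0z.
have [b bk] := zinv_sub (zinv_expz p (- k%:Z)%R).
rewrite -[E a](conjgK d) -(EJ b a); first exact: SJ (IHk _ bk) (SV Sd).
by rewrite bk ak -[X in (X * _)%R]expr1z -expfzDr // intS opprD addrA subrr add0r.
Qed.

Let rootJ (d X Y : H) : X * d = d * Y -> Y = X ^ d.
Proof. by move=> E; rewrite conjgE E mulKg. Qed.
Let rootJV (d X Y : H) : d * X = Y * d -> Y = X ^ d^-1.
Proof. by move=> E; rewrite conjgE invgK mulgA E mulgK. Qed.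

Let SE01 a : S (E01 p_pr a).
Proof.
apply: (S_root (@E01D _ p_pr) SdS) => [|b c bc].
  by have := @Sgen 2 isT; rewrite /abels_gens inordK.
by apply: rootJ; apply: entP; split; rewrite !(entM, ent_E01, ent_dS) ?bc; ring.
Qed.
Let SE12 a : S (E12 p_pr a).
Proof.
apply: (S_root (@E12D _ p_pr) SdT) => [|b c bc].
  by have := @Sgen 3 isT; rewrite /abels_gens inordK.
by apply: rootJ; apply: entP; split; rewrite !(entM, ent_E12, ent_dT) ?bc; ring.
Qed.
Let SE23 a : S (E23 p_pr a).
Proof.
apply: (S_root (@E23D _ p_pr) (SV SdT)) => [|b c bc].
  by have := @Sgen 4 isT; rewrite /abels_gens inordK.
by apply: rootJV; apply: entP; split; rewrite !(entM, ent_E23, ent_dT) ?bc; ring.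
Qed.
Let SE02 a : S (E02 p_pr a).
Proof.
apply: (S_root (@E02D _ p_pr) SdT) => [|b c bc].
  by have := @Sgen 5 isT; rewrite /abels_gens inordK.
by apply: rootJ; apply: entP; split; rewrite !(entM, ent_E02, ent_dT) ?bc; ring.
Qed.
Let SE13 a : S (E13 p_pr a).
Proof.
apply: (S_root (@E13D _ p_pr) (SV SdS)) => [|b c bc].
  by have := @Sgen 6 isT; rewrite /abels_gens inordK.
by apply: rootJV; apply: entP; split; rewrite !(entM, ent_E13, ent_dS) ?bc; ring.
Qed.

Lemma commg_E01_E13 a : E03 p_pr a = [~ (E01 p_pr a)^-1, (E13 p_pr 1%R)^-1].
Proof.
have v1 : val (1%R : Zinv p) = 1%R by exact: rmorph1.
rewrite /commg /conjg !invgK !mulgA; apply/esym/eqP.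
rewrite divg_eq divg_eq -mulgA; apply/eqP.
by apply: entP; split; rewrite !(entM, ent_E01, ent_E13, ent_E03) ?v1; ring.
Qed.

Let SE03 a : S (E03 p_pr a).
Proof.
by rewrite commg_E01_E13; apply: SM; [|apply: SJ]; do ?apply: SV; rewrite ?SE01 ?SE13.
Qed.

Let D k l : H := abels_of p_pr k l 0%R 0%R 0%R 0%R 0%R 0%R.

Let Dmul k l : D (1 + k)%R l = dS p_pr * D k l.
Proof.
by apply: entP; split; rewrite !(entM, ent_dS, ent_of) ?rmorph0 ?expfzDr // ?expr1z; ring.
Qed.

Let DmulT k l : D k (1 + l)%R = dT p_pr * D k l.
Proof.
by apply: entP; split; rewrite !(entM, ent_dT, ent_of) ?rmorph0 ?expfzDr // ?expr1z; ring.
Qed.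

(* Induction over the integers in both directions. *)
Let S_shift (F : int -> H) d : S d -> (forall k, F (1 + k)%R = d * F k) ->
  S (F 0%R) -> forall k, S (F k).
Proof.
move=> Sd FS F0; elim/int_ind => // n Fn; first by rewrite intS FS; apply: SM.
have -> : F (- n.+1%:Z)%R = d^-1 * F (- n%:Z)%R.
  by apply: (mulgI d); rewrite mulVKg -FS intS opprD addrA subrr add0r.
exact: SM (SV Sd) Fn.
Qed.

Let SD k l : S (D k l).
Proof.
apply: (@S_shift (D k) (dT p_pr)) => // {l}.
apply: (@S_shift (D^~ 0%R) (dS p_pr)) => // {k}.
rewrite (_ : D 0%R 0%R = 1) //.
by apply: entP; split; rewrite !(ent_of, ent1) ?rmorph0.
Qed.

Lemma abels_gens_generate A : exists w, eval_word abels_gens w = A.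
Proof.
have [k kE] := ent11_power A; have [l lE] := ent22_power A.
have zk x : x \in zinv p -> exists b : Zinv p, val b = (x / ent A 1 1)%R.
  by move=> zx; apply: zinv_sub; rewrite kE invr_expz rpredM ?zinv_expz.
have zl x : x \in zinv p -> exists b : Zinv p, val b = (x / ent A 2 2)%R.
  by move=> zx; apply: zinv_sub; rewrite lE invr_expz rpredM ?zinv_expz.
(* In group_scope, 1 would be the neutral element of 'I_4, that is, the index 0. *)
have [a01 E01'] := zk _ (ent_zinv A 0%R 1%R); have [a02 E02'] := zl _ (ent_zinv A 0 2).
have [a12 E12'] := zl _ (ent_zinv A 1%R 2); have [a03 E03'] := zinv_sub (ent_zinv A 0 3).
have [a13 E13'] := zinv_sub (ent_zinv A 1%R 3).
have [a23 E23'] := zinv_sub (ent_zinv A 2 3).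
have -> : A = E03 p_pr a03 * (E13 p_pr a13 * (E23 p_pr a23 * (E02 p_pr a02 *
    (E12 p_pr a12 * (E01 p_pr a01 * D k l))))).
  have nA := (e11 A, e22 A).
  apply: entP; split;
    rewrite !(entM, ent_E01, ent_E02, ent_E03, ent_E12, ent_E13, ent_E23, ent_of) ?rmorph0
      -?kE -?lE ?E01' ?E02' ?E03' ?E12' ?E13' ?E23';
    by [ring | field; rewrite ?nA].
by do ![apply: SM; first by [exact: SE01 | exact: SE02 | exact: SE03 | exact: SE12
        | exact: SE13 | exact: SE23]]; apply: SD.
Qed.

End Generation.

(** Abels' theorem. Left multiplication by a generator has the same effect on the
    entries of a matrix and on the normal form in the presented group, so that
    matrix_form is a section of the evaluation of words. *)
Theorem abels_presentation :
  presents abels_gens (fun w => w \in abels_relators p).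
Proof.
set R := fun w => _.
have relP : abels_rel p (pres_gen R (inord 0)) (pres_gen R (inord 1))
    (pres_gen R (inord 2)) (pres_gen R (inord 3)) (pres_gen R (inord 4))
    (pres_gen R (inord 5)) (pres_gen R (inord 6)).
  by apply/abels_relatorsP => r; apply: pres_gen_relator.
pose N A := matrix_form (pres_gen R (inord 0)) (pres_gen R (inord 1))
    (pres_gen R (inord 2)) (pres_gen R (inord 3)) (pres_gen R (inord 4))
    (pres_gen R (inord 5)) (pres_gen R (inord 6)) A.
apply: (@presents_section _ _ _ _ N).
- exact: abels_gens_generate.
- exact/abels_relatorsP/abels_gens_rel.
- exact: (matrix_form1 p_pr relP).
move=> i A; rewrite -[i]inord_val; case: i => k k7 /=; rewrite /abels_gens inordK //.
case: k k7 => [|[|[|[|[|[|[|//]]]]]]] _ /=.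
- exact: (matrix_form_s relP).
- exact: (matrix_form_t relP).
- exact: (matrix_form_x12 relP).
- exact: (matrix_form_x23 relP).
- exact: (matrix_form_x34 relP).
- exact: (matrix_form_x13 relP).
- exact: (matrix_form_x24 relP).
Qed.

End AbelsGroup.

(** * Centre, derived series and torsion *)

Section AbelsStructure.
Variables (p : nat) (p_pr : prime p).
Local Notation H := (abels p_pr).
Implicit Types (A B : H) (a : Zinv p).

Let p_gt0 : (0 < p)%N := prime_gt0 p_pr.
Let pn0 : p%:R != 0 :> rat := pR_neq0 p_gt0.
Let pn1 : p%:R != 1 :> rat.
Proof. by rewrite pnatr_eq1 neq_ltn prime_gt1 ?orbT. Qed.
Let v1 : val (1 : Zinv p) = 1. Proof. exact: rmorph1. Qed.
Let e11 A : ent A 1 1 != 0 := lt0r_neq0 (ent11_gt0 A).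
Let e22 A : ent A 2 2 != 0 := lt0r_neq0 (ent22_gt0 A).

Lemma E03_inj : injective (E03 p_pr).
Proof. by move=> a b ab; apply: val_inj; rewrite -(ent_E03 p_pr a) ab ent_E03. Qed.

Lemma E03_center a : E03 p_pr a \in center H.
Proof.
by apply/asboolP=> B; apply: entP; split; rewrite !(entM, ent_E03); ring.
Qed.

(** A central matrix commutes with the torus, which leaves only the diagonal and
    the corner, and with E01 and E23, which forces the diagonal to be 1. *)
Lemma center_entries A : A \in center H ->
  [/\ ent A 1 1 = 1, ent A 2 2 = 1, ent A 0 1 = 0 & ent A 0 2 = 0] /\
  [/\ ent A 1 2 = 0, ent A 1 3 = 0 & ent A 2 3 = 0].
Proof.
move=> /asboolP cA.
have c B i j : ent (A * B)%g i j = ent (B * A)%g i j by rewrite cA.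
have unscale (x : rat) : x * p%:R = x -> x = 0.
  move=> E; have /eqP : x * (p%:R - 1) = 0 by rewrite mulrBr E mulr1 subrr.
  by rewrite mulf_eq0 subr_eq0 (negPf pn1) orbF => /eqP.
have z01 : ent A 0 1 = 0.
  by apply: unscale; have := c (dS p_pr) 0 1; rewrite !(entM, ent_dS) !(mul0r, mulr0, add0r, addr0).
have z12 : ent A 1 2 = 0.
  apply: unscale; have := c (dS p_pr) 1 2; rewrite !(entM, ent_dS) => E; move: E.
  by rewrite !(mulr0, mul0r, add0r, addr0, mulr1) mulrC.
have z13 : ent A 1 3 = 0.
  apply: unscale; have := c (dS p_pr) 1 3; rewrite !(entM, ent_dS).
  by rewrite !(mulr0, mul0r, add0r, addr0, mulr1) mulrC.
have z02 : ent A 0 2 = 0.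
  by apply: unscale; have := c (dT p_pr) 0 2; rewrite !(entM, ent_dT) !(mul0r, mulr0, add0r, addr0).
have z23 : ent A 2 3 = 0.
  apply: unscale; have := c (dT p_pr) 2 3; rewrite !(entM, ent_dT).
  by rewrite !(mulr0, mul0r, add0r, addr0, mulr1) mulrC.
have o11 : ent A 1 1 = 1.
  have := c (E01 p_pr 1) 0 1; rewrite !(entM, ent_E01) v1 z01.
  by rewrite mul0r addr0 add0r mul1r.
have o22 : ent A 2 2 = 1.
  have := c (E23 p_pr 1) 2 3; rewrite !(entM, ent_E23) v1 z23.
  by rewrite !(mulr0, mulr1, addr0, add0r).
by [].
Qed.

Lemma centerE A : A \in center H -> exists a, A = E03 p_pr a.
Proof.
move=> /center_entries[[? ? ? ?] [? ? ?]].
have [a aE] := zinv_sub (ent_zinv A 0 3); exists a.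
by apply: entP; split; rewrite ent_E03.
Qed.

Lemma center_ent03 A B : A \in center H -> B \in center H ->
  ent A 0 3 = ent B 0 3 -> A = B.
Proof.
move=> /centerE[a ->] /centerE[b ->]; rewrite !ent_E03 => ab.
by congr E03; apply: val_inj.
Qed.

(** ** Solubility *)

(** Unipotent matrices, then those that vanish on the first superdiagonal, then the
    trivial group: each contains the commutators of the previous one. *)
Let L i : {pred H} := fun A => match i with
  | 0 => true
  | 1 => (ent A 1 1 == 1) && (ent A 2 2 == 1)
  | 2 => [&& ent A 1 1 == 1, ent A 2 2 == 1, ent A 0 1 == 0, ent A 1 2 == 0 & ent A 2 3 == 0]
  | _ => A == 1%g
  end.

Let L1P A : reflect (ent A 1 1 = 1 /\ ent A 2 2 = 1) (A \in L 1).
Proof. by apply: (iffP andP) => -[/eqP ? /eqP ?]. Qed.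

Let L2P A : reflect ([/\ ent A 1 1 = 1, ent A 2 2 = 1, ent A 0 1 = 0, ent A 1 2 = 0
  & ent A 2 3 = 0]) (A \in L 2).
Proof. by apply: (iffP and5P) => -[/eqP ? /eqP ? /eqP ? /eqP ? /eqP ?]. Qed.

Let L_group i : group_closed (L i).
Proof.
case: i => [|[|[|i]]].
- by [].
- split=> [|A B /L1P[A1 A2] /L1P[B1 B2]]; first by apply/L1P; rewrite !ent1.
  move: (A / B)%g (mulgVK B A) => C CB; apply/L1P; move: A1 A2.
  by rewrite -CB !entM B1 B2 !mulr1.
- split=> [|A B /L2P[A1 A2 A01 A12 A23] /L2P[B1 B2 B01 B12 B23]].
    by apply/L2P; rewrite !ent1.
  move: (A / B)%g (mulgVK B A) => C CB; apply/L2P; move: A1 A2 A01 A12 A23.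
  rewrite -CB !entM B1 B2 B01 B12 B23 !(mulr1, mulr0, add0r, addr0).
  by move=> -> -> -> -> ->.
- by split=> [|A B /eqP-> /eqP->]; apply/eqP; rewrite ?mulgV.
Qed.

Lemma soluble_abels : soluble H.
Proof.
apply: (@soluble_series _ L 3) => // i A B.
case: i => [_ _|[|[|i]]]; last by move=> /eqP-> _; apply/eqP; rewrite comm1g.
all: move: [~ A, B]%g (commgC A B) => C CE.
all: have R j k : ent (A * B)%g j k = ent (B * A * C)%g j k by rewrite CE.
- apply/L1P; have := R 1 1; have := R 2 2; rewrite !entM => R2 R1.
  split; [apply: (mulfI (mulf_neq0 (e11 B) (e11 A))) | apply: (mulfI (mulf_neq0 (e22 B) (e22 A)))].
    by rewrite -R1 mulr1 mulrC.
  by rewrite -R2 mulr1 mulrC.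
- move=> /L1P[A1 A2] /L1P[B1 B2].
  apply/L2P; have := R 1 1; have := R 2 2.
  rewrite !entM A1 A2 B1 B2 !mul1r => /esym E2 /esym E1.
  have := R 0 1; have := R 1 2; have := R 2 3.
  rewrite !entM A1 A2 B1 B2 E1 E2 !(mul1r, mulr1) => R23 R12 R01; split=> //.
  + by apply: (addIr (ent A 0 1 + ent B 0 1)); rewrite -R01; ring.
  + by apply: (addIr (ent A 1 2 + ent B 1 2)); rewrite -R12; ring.
  + by apply: (addIr (ent A 2 3 + ent B 2 3)); rewrite -R23; ring.
- move=> /L2P[A1 A2 A01 A12 A23] /L2P[B1 B2 B01 B12 B23].
  apply/eqP; apply: (mulgI (B * A)%g); rewrite -CE mulg1.
  by apply: entP; split; rewrite !entM ?A1 ?A2 ?A01 ?A12 ?A23 ?B1 ?B2 ?B01 ?B12 ?B23; ring.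
Qed.

(** ** The central quotient is torsion-free *)

Let entX1 (n : nat) A : ent (A ^+ n)%g 1 1 = ent A 1 1 ^+ n.
Proof. by elim: n => [|n IHn]; rewrite ?ent1 // expgS entM IHn exprS. Qed.
Let entX2 (n : nat) A : ent (A ^+ n)%g 2 2 = ent A 2 2 ^+ n.
Proof. by elim: n => [|n IHn]; rewrite ?ent1 // expgS entM IHn exprS. Qed.

(** The diagonal entries are positive with n-th power 1, hence equal to 1; then the
    n-th power multiplies by n the entries on the first superdiagonal and, once
    these are known to vanish, those on the second. *)
Lemma center_root A n : (0 < n)%N -> (A ^+ n)%g \in center H -> A \in center H.
Proof.
move=> n0 /center_entries[[Z1 Z2 Z01 Z02] [Z12 Z13 Z23]].
have root1 (x : rat) : 0 < x -> x ^+ n = 1 -> x = 1.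
  by move=> x0 /eqP; rewrite pexpr_eq1 ?(ltW x0) // => /eqP.
have root0 (x : rat) : x *+ n = 0 -> x = 0.
  by move=> /eqP; rewrite mulrn_eq0 -leqn0 leqNgt n0 => /eqP.
have A1 : ent A 1 1 = 1 by apply: root1 (ent11_gt0 A) _; rewrite -entX1.
have A2 : ent A 2 2 = 1 by apply: root1 (ent22_gt0 A) _; rewrite -entX2.
have X1 k : ent (A ^+ k)%g 1 1 = 1 by rewrite entX1 A1 expr1n.
have X2 k : ent (A ^+ k)%g 2 2 = 1 by rewrite entX2 A2 expr1n.
have X01 k : ent (A ^+ k)%g 0 1 = ent A 0 1 *+ k.
  by elim: k => [|k IHk]; rewrite ?ent1 // expgS entM X1 IHk mulr1 -mulrSr.
have X12 k : ent (A ^+ k)%g 1 2 = ent A 1 2 *+ k.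
  by elim: k => [|k IHk]; rewrite ?ent1 // expgS entM A1 X2 IHk mulr1 mul1r -mulrSr.
have X23 k : ent (A ^+ k)%g 2 3 = ent A 2 3 *+ k.
  by elim: k => [|k IHk]; rewrite ?ent1 // expgS entM A2 IHk mul1r -mulrSr.
have A01 : ent A 0 1 = 0 by apply: root0; rewrite -X01.
have A12 : ent A 1 2 = 0 by apply: root0; rewrite -X12.
have A23 : ent A 2 3 = 0 by apply: root0; rewrite -X23.
have X02 k : ent (A ^+ k)%g 0 2 = ent A 0 2 *+ k.
  by elim: k => [|k IHk]; rewrite ?ent1 // expgS entM A01 X2 IHk mul0r addr0 mulr1 -mulrSr.
have X13 k : ent (A ^+ k)%g 1 3 = ent A 1 3 *+ k.
  by elim: k => [|k IHk]; rewrite ?ent1 // expgS entM A1 A12 IHk mul0r addr0 mul1r -mulrSr.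
have A02 : ent A 0 2 = 0 by apply: root0; rewrite -X02.
have A13 : ent A 1 3 = 0 by apply: root0; rewrite -X13.
have [a aE] := zinv_sub (ent_zinv A 0 3).
rewrite (_ : A = E03 p_pr a) ?E03_center //.
by apply: entP; split; rewrite ent_E03.
Qed.

End AbelsStructure.

(** * Recursive enumerations of words *)

Section RecursiveUnary.
Local Open Scope nat_scope.
Implicit Types (f g a : nat -> nat) (c n : nat).

(** A unary view of the k-ary recursive functions, closed under composition and
    iteration: all that enumerating the codes requires. *)
Definition recursive1 f := recursive (fun v : 1.-tuple nat => f (thead v)).

Lemma eq_recursive k (f g : k.-tuple nat -> nat) : f =1 g -> recursive f -> recursive g.
Proof. by move=> /funext->. Qed.

Lemma recursive1_id : recursive1 id.
Proof. exact: (recursive_proj ord0). Qed.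

Lemma recursive1_comp f g : recursive1 f -> recursive1 g -> recursive1 (f \o g).
Proof.
move=> rf rg; have := recursive_comp rf (fun _ : 'I_1 => rg).
by apply: eq_recursive => v /=; rewrite /thead tnth_mktuple.
Qed.

Lemma recursive1_const c : recursive1 (fun=> c).
Proof.
elim: c => [|c IHc]; first exact: recursive_zero.
exact: (recursive1_comp (f := succn) recursive_succ IHc).
Qed.

(** Iteration is the binary function h(y, m) = f^y(m), defined by primitive
    recursion on y, evaluated at (k, a k). *)
Lemma recursive1_iter f a :
  recursive1 f -> recursive1 a -> recursive1 (fun k => iter k f (a k)).
Proof.
move=> rf ra.
pose h (v : 2.-tuple nat) := iter (tnth v ord0) f (tnth v ord_max).
have rh : recursive h.
  pose g (v : 3.-tuple nat) := f (tnth v (inord 1)).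
  have rg : recursive g.
    have := recursive_comp rf (fun _ : 'I_1 => recursive_proj (inord 1 : 'I_3)).
    by apply: eq_recursive => v /=; rewrite /g /thead tnth_mktuple.
  apply: (recursive_prim recursive1_id rg) => [v|y v].
    by rewrite /h /thead !(tnth_nth 0).
  by rewrite /g /h !(tnth_nth 0) /= inordK.
pose gs (i : 'I_2) : 1.-tuple nat -> nat :=
  if i == ord0 then fun v => thead v else fun v => a (thead v).
have rgs i : recursive (gs i).
  by rewrite /gs; case: (i == ord0); [apply: recursive1_id | apply: ra].
have := recursive_comp rh rgs.
by apply: eq_recursive => v; rewrite /h !tnth_mktuple.
Qed.

Lemma recursive1_cons c f :
  recursive1 f -> recursive1 (fun k => if k is k'.+1 then f k' else c).
Proof.
move=> rf; pose h (v : 1.-tuple nat) := if thead v is k'.+1 then f k' else c.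
have rg : recursive (fun v : 2.-tuple nat => f (tnth v ord0)).
  have := recursive_comp rf (fun _ : 'I_1 => recursive_proj (ord0 : 'I_2)).
  by apply: eq_recursive => v /=; rewrite /thead tnth_mktuple.
have rc : recursive (fun _ : 0.-tuple nat => c).
  elim: c {h} => [|c IHc]; first exact: recursive_zero.
  have := recursive_comp recursive_succ (fun _ : 'I_1 => IHc).
  by apply: eq_recursive => v /=; rewrite /thead tnth_mktuple.
by apply: (recursive_prim (h := h) rc rg) => // y v; rewrite /h /thead !(tnth_nth 0).
Qed.

Lemma recursive1_cat (s : seq nat) f : recursive1 f -> exists2 g, recursive1 g &
  forall m, (exists k, g k = m) <-> m \in s \/ exists k, f k = m.
Proof.
move=> rf; elim: s => [|c s [g rg gE]].
  by exists f => // m; split=> [|[]//]; right.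
exists (fun k => if k is k'.+1 then g k' else c); first exact: recursive1_cons.
move=> m; rewrite in_cons; split=> [[[|k] <-]|[/orP[/eqP->|ms]|fm]].
- by left; rewrite eqxx.
- by have /gE[->|] : exists j, g j = g k by [exists k]; [left; rewrite orbT | right].
- by exists 0.
- by have /gE[k <-] : m \in s \/ exists k, f k = m by [left]; exists k.+1.
- by have /gE[k <-] : m \in s \/ exists k, f k = m by [right]; exists k.+1.
Qed.

(** The effect of prepending n on the code of a sequence. *)
Definition code_step n c := 2 ^ n * c.*2.+1.

Lemma recursive1_code_step n : recursive1 (code_step n).
Proof.
have rS : recursive1 succn := recursive_succ.
have rd : recursive1 double.
  have := recursive1_iter (recursive1_comp rS rS) (recursive1_const 0).
  apply: eq_recursive => v; rewrite /=; by elim: (thead v) => //= k ->.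
have -> : code_step n = iter n (fun f => double \o f) (succn \o double).
  elim: n => [|n IHn]; apply/funext=> c; first by rewrite /code_step mul1n.
  by rewrite iterS /= -IHn /code_step expnS -mulnA mul2n.
elim: n => [|n IHn]; first exact: recursive1_comp rS rd.
exact: recursive1_comp rd IHn.
Qed.

End RecursiveUnary.

Section WordFamilies.
Variable n : nat.

(** Families of words obtained from powers of letters by concatenation have a
    recursive sequence of codes: prepending a letter applies code_step, and
    prepending its k-th power iterates it k times. *)
Definition rec_family (w : nat -> word n) := recursive1 (fun k => word_code (w k)).

Lemma rec_family_nil : rec_family (fun=> [::]).
Proof. exact: recursive1_const. Qed.

Lemma rec_family_cons a w : rec_family w -> rec_family (fun k => a :: w k).
Proof. exact: recursive1_comp (recursive1_code_step (a.1.*2 + a.2)%N). Qed.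

Lemma rec_family_nseq a w : rec_family w -> rec_family (fun k => nseq k a ++ w k).
Proof.
move=> rw; have := recursive1_iter (recursive1_code_step (a.1.*2 + a.2)%N) rw.
apply: eq_recursive => v; rewrite /=; move: (w (thead v)) => u.
by elim: (thead v) => //= k ->.
Qed.

Lemma rec_enumerable_family (rels : seq (word n)) (w : nat -> word n) :
  rec_family w ->
  rec_enumerable (fun m => exists2 r, r \in rels \/ (exists k, w k = r) & word_code r = m).
Proof.
move=> /(recursive1_cat [seq word_code r | r <- rels])[g rg gE]; right.
exists (fun v => g (thead v)) => // m; split=> [[r [rR|[k <-]] <-]|].
- have /gE[k gk] : word_code r \in [seq word_code r | r <- rels] \/
    exists k, word_code (w k) = word_code r by left; apply: map_f.
  by exists k.
- have /gE[j gj] : word_code (w k) \in [seq word_code r | r <- rels] \/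
    exists j, word_code (w j) = word_code (w k) by right; exists k.
  by exists j.
case=> k gk; have /gE[/mapP[r rR ->]|[j <-]] : exists k, g k = m by exists k.
  by exists r => //; left.
by exists (w j) => //; right; exists j.
Qed.

End WordFamilies.

(** * Subgroups of the centre *)

Section CentralSubgroups.
Variables (p : nat) (p_pr : prime p).
Local Notation H := (abels p_pr).
Implicit Types (A B : H) (a b r : Zinv p) (T : {pred H}).

Let p_gt0 : (0 < p)%N := prime_gt0 p_pr.
Let pn0 : p%:R != 0 :> rat := pR_neq0 p_gt0.

Definition pz (e : int) : Zinv p := Sub (p%:R ^ e) (zinv_expz p e).

Lemma val_pz e : val (pz e) = p%:R ^ e. Proof. exact: SubK. Qed.

Lemma E03_0 : E03 p_pr 0 = 1%g.
Proof. exact/add_morph0/E03D. Qed.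

Lemma E03_opp a : E03 p_pr (- a) = (E03 p_pr a)^-1%g.
Proof. exact/add_morphN/E03D. Qed.

Lemma mem_E03_mulz T a k : group_closed T -> E03 p_pr a \in T -> E03 p_pr (a *~ k) \in T.
Proof.
move=> gT Ta; have TX n : E03 p_pr (a *+ n) \in T.
  by rewrite (add_morphX (@E03D _ p_pr)); apply: group_closedX.
by case: k => n; [exact: TX | rewrite NegzE mulrNz E03_opp; apply/(group_closedV gT)/TX].
Qed.

Lemma center_sub T : group_closed T -> (forall k : nat, E03 p_pr (pz (- k%:Z)) \in T) ->
  {subset center H <= T}.
Proof.
move=> gT Tk A /centerE[a ->]; move: a.
apply: (zinv_morph_ind (P := fun A => A \in T)) => [|x y|x|k a ak].
- exact: E03D.
- exact: group_closedM.
- exact: group_closedV.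
- by rewrite (_ : a = pz (- k%:Z)) //; apply: val_inj; rewrite ak val_pz.
Qed.

(** Finitely many elements of Z[1/p] have a common denominator p^K, and
    1/p^(K+1) is not among the fractions with that denominator. *)
Lemma center_not_fg (s : seq H) : {in s, forall z, z \in center H} ->
  exists2 T : {pred H}, group_closed T & {subset s <= T} /\
    exists2 z, z \in center H & z \notin T.
Proof.
move=> sZ.
pose T K : {pred H} := fun A =>
  `[< A \in center H /\ exists n : int, ent A 0 3 * p%:R ^+ K = n%:~R >].
have TS A K L : A \in T K -> A \in T (K + L)%N.
  move=> /asboolP[ZA [n nE]]; apply/asboolP; split=> //.
  by exists (n * p%:Z ^+ L); rewrite exprD mulrA nE rmorphM rmorphXn.
have [ZM ZV] := (group_closedM (center_group H), group_closedV (center_group H)).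
have gT K : group_closed (T K).
  split=> [|A B].
    apply/asboolP; split; first by case: (center_group H).
    by exists 0; rewrite ent1 mul0r.
  move=> /asboolP[ZA [n nE]] /asboolP[ZB [m mE]]; apply/asboolP.
  split; first by apply: ZM => //; apply: ZV.
  exists (n - m); move: ZA ZB nE mE => /centerE[a ->] /centerE[b ->].
  by rewrite -E03_opp -E03D !ent_E03 rmorphB /= mulrBl => -> ->; rewrite rmorphB.
have [K sK] : exists K, {subset s <= T K}.
  elim: s sZ => [|z s IHs] sZ; first by exists 0%N.
  have [|K sK] := IHs; first by move=> y ys; apply: sZ; rewrite inE ys orbT.
  have Zz : z \in center H by apply: sZ; rewrite inE eqxx.
  have [n [L zE]] : exists (n : int) (L : nat), ent z 0 3 = n%:~R / p%:R ^+ L.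
    exact/asboolP/ent_zinv.
  exists (K + L)%N => y; rewrite inE => /orP[/eqP->|/sK/TS]; last exact.
  rewrite addnC; apply: TS; apply/asboolP; split=> //; exists n.
  by rewrite zE mulfVK // expf_neq0.
exists (T K) => //; split=> //; exists (E03 p_pr (pz (- K.+1%:Z))); first exact: E03_center.
apply/asboolP => -[_ [n]]; rewrite ent_E03 val_pz -[_ ^+ K]/(p%:R ^ K%:Z) -expfzDr //.
rewrite intS opprD addrNK exprN1 => E.
have : (n * p%:Z)%:~R = 1%:~R :> rat by rewrite rmorphM /= -E mulVf.
move/intr_inj/(congr1 absz)/eqP; rewrite abszM muln_eq1 => /andP[_ /eqP p1].
by have := prime_gt1 p_pr; rewrite -[p]/(absz p) p1.
Qed.

(** ** Words for a generating family of the centre *)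

Definition corner_word (k : nat) : word 7 :=
  let s := abels_letter 0 in let x12 := abels_letter 2 in let x24 := abels_letter 6 in
  nseq k s ++ x12 :: nseq k (inv_letter s) ++ x24 ::
  nseq k s ++ inv_letter x12 :: nseq k (inv_letter s) ++ [:: inv_letter x24].

Lemma rec_family_corner : rec_family corner_word.
Proof.
by do ![apply: rec_family_cons | apply: rec_family_nseq | apply: rec_family_nil].
Qed.

Let dS_conj (k : nat) :
  (dS p_pr ^+ k * E01 p_pr 1%R)%g = (E01 p_pr (pz (- k%:Z)) * dS p_pr ^+ k)%g.
Proof.
elim: k => [|k IHk].
  by rewrite mul1g mulg1; congr E01; apply: val_inj; rewrite val_pz oppr0 rmorph1.
rewrite !expgS -mulgA IHk !mulgA; congr (_ * _)%g.
apply: entP; split; rewrite !(entM, ent_dS, ent_E01) ?val_pz; try ring.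
by rewrite intS opprD expfzDr // exprN1; field.
Qed.

(** The corner is the commutator of the entries (1,2) and (2,4), and the torus
    turns the parameter 1 of the former into p^-k. *)
Lemma eval_corner_word k :
  eval_word (abels_gens p_pr) (corner_word k) = E03 p_pr (pz (- k%:Z)).
Proof.
rewrite /corner_word !(eval_word_cat, eval_word_cons, eval_word_nseq, eval_word_nil).
rewrite !eval_letter_inv /eval_letter /abels_letter /= /abels_gens !inordK //= mulg1.
have V : (dS p_pr ^+ k * (E01 p_pr 1%R)^-1 = (E01 p_pr (pz (- k%:Z)))^-1 * dS p_pr ^+ k)%g.
  by apply: (mulgI (E01 p_pr (pz (- k%:Z)))); rewrite mulVKg mulgA -dS_conj mulgK.
rewrite !expVgn (mulgA (dS p_pr ^+ k)%g (E01 _ _)) dS_conj -mulgA mulVKg.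
rewrite (mulgA (dS p_pr ^+ k)%g (E01 _ _)^-1%g) V -mulgA mulVKg.
by rewrite commg_E01_E13 /commg /conjg !invgK !mulgA.
Qed.

End CentralSubgroups.

(** * The quotient by an infinite cyclic central subgroup *)

Section ZinvMod.
Variables (p : nat) (r : Zinv p).
Local Open Scope quotient_scope.

Definition zinv_mod_map (a : Algebra.to_multiplicative (Zinv p)) : zinv_mod r :=
  \pi_(Quotient.quot (multiples r)) (a : Zinv p).

Lemma zinv_mod_mapM : {morph zinv_mod_map : a b / (a * b)%g}.
Proof. exact: Quotient.pi_add. Qed.

Lemma zinv_mod_map_surj x : exists a, zinv_mod_map a = x.
Proof. by exists (repr (x : Quotient.quot (multiples r))); apply: reprK. Qed.

Lemma zinv_mod_map_ker (a : Zinv p) : zinv_mod_map a = 1%g <-> a \in multiples r.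
Proof.
have -> : (1%g : zinv_mod r) = zinv_mod_map (0 : Zinv p) by rewrite (morph_1 zinv_mod_mapM).
by rewrite -[a in a \in _]subr0 Quotient.idealrBE; split=> [/eqP|/eqP].
Qed.

End ZinvMod.

Section CyclicQuotient.
Variables (p : nat) (p_pr : prime p).
Local Notation H := (abels p_pr).
Local Notation pz := (pz p).
Variables (C : {pred abels p_pr}) (gC : group_closed C).
Hypothesis sCZ : {subset C <= center (abels p_pr)}.
Implicit Types (A B : H) (a b r : Zinv p).

Let p_gt0 : (0 < p)%N := prime_gt0 p_pr.
Let pn0 : p%:R != 0 :> rat := pR_neq0 p_gt0.

Let val_pzM e (m : nat) : val (pz e * m%:R) = p%:R ^ e * m%:R.
Proof. by rewrite rmorphM rmorph_nat -val_pz. Qed.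

Let val_Mn (a : Zinv p) n : val (a *+ n) = val a *+ n. Proof. exact: raddfMn. Qed.
Let val_Mz (a : Zinv p) n : val (a *~ n) = val a *~ n. Proof. exact: raddfMz. Qed.

Let pzM e f : pz e * pz f = pz (e + f).
Proof. by apply: val_inj; rewrite val_pz expfzDr // -!val_pz; apply: rmorphM. Qed.
Let pz0 : pz 0 = 1.
Proof. by apply: val_inj; rewrite val_pz expr0z rmorph1. Qed.

(** C is the cyclic group generated by the central matrix with corner r. *)
Definition cyclic_on r := forall A, A \in C <-> exists k : int, A = E03 p_pr (r *~ k).

Lemma cyclic_onP : isomorphic (subgrp gC) (Algebra.to_multiplicative int) ->
  exists2 r, r != 0 & cyclic_on r.
Proof.
move=> [f [g fK gK]].
have gM : {morph g : k l / (k * l)%g} by apply: (can2_gmulfM fK gK).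
have bP (k : int) : exists a, val (g k) = E03 p_pr a.
  by apply/centerE/sCZ/(valP (g k)).
pose b k := projT1 (cid (bP k)).
have bE k : val (g k) = E03 p_pr (b k) by rewrite /b; case: (cid _).
have bD k l : b (k + l) = b k + b l.
  apply: (@E03_inj _ p_pr); rewrite E03D -!bE.
  by rewrite -[LHS]/(val (g ((k : Algebra.to_multiplicative int) * l)%g)) gM.
have b0 : b 0 = 0 by apply: (addrI (b 0)); rewrite -bD !addr0.
have bN k : b (- k) = - b k.
  by apply: (addrI (b k)); rewrite -bD !subrr b0.
have bn (n : nat) : b n%:Z = b 1 *+ n.
  by elim: n => [|n IHn]; rewrite ?mulr0n // intS bD IHn mulrS.
have bz k : b k = b 1 *~ k.
  by case: k => n; rewrite ?NegzE ?bN ?mulrNz bn.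
exists (b 1); first apply/eqP=> b10.
  have /(can_inj gK) : g 1 = g 0 by apply: val_inj; rewrite !bE b10 b0.
  by [].
move=> A; split=> [CA | [k ->]]; last by rewrite -bz -bE; apply: valP.
exists (f (Sub A CA)); rewrite -bz -bE fK.
by rewrite SubK.
Qed.

(** Every nonzero element of Z[1/p] is a unit times an integer prime to p. *)
Lemma cyclic_on_normal r : r != 0 -> cyclic_on r ->
  exists e (m : nat), coprime p m /\ cyclic_on (pz e * m%:R).
Proof.
move=> r0 Cr; have /asboolP[n [j rE]] := valP r.
have n0 : (0 < `|n|)%N.
  rewrite absz_gt0; apply: contraNneq r0 => n0.
  by apply/eqP/val_inj; rewrite rE n0 rmorph0 mul0r.
have [m pm] := pfactor_coprime p_pr n0; move: (logn p `|n|) => l nE.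
exists (l%:Z - j%:Z), m; split=> // A.
have E : pz (l%:Z - j%:Z) * m%:R = r \/
         pz (l%:Z - j%:Z) * m%:R = - r.
  have vE : val (pz (l%:Z - j%:Z) * m%:R) = `|n|%N%:R / p%:R ^+ j.
    rewrite val_pzM expfzDr // nE natrM natrX.
    by rewrite -invr_expz mulrC mulrA.
  have [np|np] := leP 0 n; [left | right]; apply: val_inj; rewrite vE.
    by rewrite rE pmulrn gez0_abs.
  by rewrite rmorphN /= rE -mulNr -rmorphN pmulrn ltz0_abs.
split=> [/Cr[k ->]|[k ->]]; case: E => ->.
- by exists k.
- by exists (- k); rewrite mulrNz mulNrz opprK.
- by apply/Cr; exists k.
- by apply/Cr; exists (- k); rewrite mulrNz mulNrz.
Qed.

Lemma cyclic_on_generated r : cyclic_on r <-> C =i generated (pred1 (E03 p_pr r)).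
Proof.
have gE := generated_group (pred1 (E03 p_pr r)).
have rE : E03 p_pr r \in generated (pred1 (E03 p_pr r)) by apply: mem_generated; rewrite inE.
have E A : A \in generated (pred1 (E03 p_pr r)) <-> exists k : int, A = E03 p_pr (r *~ k).
  split=> [|[k ->]]; last exact: mem_E03_mulz.
  pose T : {pred H} := fun A => `[< exists k : int, A = E03 p_pr (r *~ k) >].
  suff sT : {subset generated (pred1 (E03 p_pr r)) <= T} by move/sT/asboolP.
  apply: generated_sub => [|x /eqP->]; last by apply/asboolP; exists 1; rewrite mulr1z.
  split=> [|x y /asboolP[k ->] /asboolP[l ->]]; apply/asboolP.
    by exists 0; rewrite mulr0z E03_0.
  by exists (k - l); rewrite mulrzBr E03D E03_opp.
split=> [Cr A | CE A]; last by rewrite CE; apply: E.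
by apply/idP/idP=> [/Cr/E | /E/Cr].
Qed.

Local Notation nC := (sub_center_normal gC sCZ).
Local Notation G := (quotg nC).
Local Notation q := (quotg_map nC).

(** As S contains the kernel C, it is saturated for the quotient map. *)
Lemma mem_quotg_image (S : {pred H}) A : group_closed S -> {subset C <= S} ->
  q A \in quotg_image nC S <-> A \in S.
Proof.
move=> gS CS; split=> [/asboolP[B SB E] | SA]; last by apply/asboolP; exists A.
have /quotg_map_ker/CS : q (B^-1 * A)%g = 1%g.
  by rewrite quotg_mapM (morph_V (@quotg_mapM _ _ nC)) E -[X in (X^-1 * _)%g]/(q B) mulVg.
move=> SBA; rewrite -[A](mulVKg B); exact: group_closedM.
Qed.

Section CyclicKernel.
Variables (e : int) (m : nat).
Hypotheses (pm : coprime p m) (Cem : cyclic_on (pz e * m%:R)).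

Let m_gt0 : (0 < m)%N.
Proof.
by case: m pm => //; rewrite /coprime gcdn0 => /eqP p1; have := prime_gt1 p_pr; rewrite p1.
Qed.

Lemma torsion_quotient : torsion G =i quotg_image nC (center H).
Proof.
have qM := @quotg_mapM _ _ nC; have qX := morph_X qM.
move=> x; apply/idP/idP.
  apply: generated_sub; first exact: (@image_group _ _ _ qM _ (center_group H)).
  move=> y /asboolP[n n0]; have [A <-] := quotg_map_surj y.
  rewrite -qX => /quotg_map_ker/sCZ/(center_root n0) ZA.
  by apply/asboolP; exists A.
case/asboolP=> A ZA ->; apply: mem_generated; apply/asboolP.
have [a ->] := centerE ZA; have /asboolP[n [j aE]] := valP a.
(* With a = n / p^j, the integer m p^(|e|+j) a is p^e m times n p^(|e|-e). *)
exists (m * p ^ (`|e| + j))%N; first by rewrite muln_gt0 m_gt0 expn_gt0 p_gt0.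
rewrite -[X in (X ^+ _)%g]/(q _) -qX; apply/quotg_map_ker/Cem.
rewrite -(add_morphX (@E03D _ p_pr)); exists (n * p%:Z ^+ absz (`|e|%:Z - e)).
congr E03; apply: val_inj; rewrite val_Mn val_Mz val_pzM aE.
rewrite -[_ *+ (m * _)]mulr_natr -[RHS]mulrzr natrM natrX rmorphM rmorphXn exprD.
have -> : (p%:R : rat) ^+ absz (`|e|%:Z - e) = p%:R ^+ `|e| * p%:R ^ (- e).
  by rewrite -[LHS]/(p%:R ^ (absz _)%:Z) gez0_abs ?expfzDr // subr_ge0 abszE ler_norm.
by rewrite -invr_expz; field; rewrite ?expf_neq0 ?expfz_neq0.
Qed.

Let TorG : groupType := subgrp (torsion_group G).

Let corner_tor (a : Zinv p) : q (E03 p_pr (pz e * a)) \in torsion G.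
Proof.
rewrite torsion_quotient; apply/mem_quotg_image; [exact: center_group | exact: sCZ|].
exact: E03_center.
Qed.

(** The factor p^e, a unit of Z[1/p], turns the kernel into the multiples of m. *)
Definition torsion_map (a : Algebra.to_multiplicative (Zinv p)) : TorG :=
  Sub (q (E03 p_pr (pz e * (a : Zinv p)))) (corner_tor a).

Lemma torsion_mapM : {morph torsion_map : a b / (a * b)%g}.
Proof.
move=> a b; apply: val_inj; rewrite [RHS]valM !SubK -quotg_mapM -E03D.
by rewrite -mulrDr.
Qed.

Let pzK (a : Zinv p) : pz e * (pz (- e) * a) = a.
Proof.
by rewrite mulrA pzM subrr pz0 mul1r.
Qed.

Lemma torsion_map_surj x : exists a, torsion_map a = x.
Proof.
have := valP x; rewrite torsion_quotient => /asboolP[A /centerE[a ->] xE].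
exists (pz (- e) * a); apply: val_inj; rewrite SubK pzK.
by rewrite xE.
Qed.

Lemma torsion_map_ker (a : Zinv p) : torsion_map a = 1%g <-> a \in multiples (m%:R : Zinv p).
Proof.
have pzI : injective (fun a => pz e * a).
  move=> b c E; rewrite -[b]mul1r -[c]mul1r.
  by rewrite -pz0 -(addNr e) -pzM -!mulrA E.
have -> : torsion_map a = 1%g <-> E03 p_pr (pz e * a) \in C.
  have E : val (torsion_map a) = q (E03 p_pr (pz e * a)) by exact: SubK.
  have E1 : val (1%g : TorG) = 1%g by [].
  by rewrite -(quotg_map_ker nC) -E -E1; split=> [->//|]; apply: val_inj.
rewrite Cem; split=> [[k /E03_inj]|/asboolP[k ->]].
  by rewrite -mulrzAr => /pzI aE; apply/asboolP; exists k.
by exists k; congr E03; rewrite mulrzAr.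
Qed.

Lemma isomorphic_torsion : isomorphic TorG (zinv_mod (m%:R : Zinv p)).
Proof.
apply: (isomorphic_of_kernels torsion_mapM (@zinv_mod_mapM _ _) torsion_map_surj).
  exact: zinv_mod_map_surj.
by move=> a; rewrite torsion_map_ker zinv_mod_map_ker.
Qed.

(** In Z[1/p]/Z every order is a power of p, while torsion_map 1 has order m. *)
Lemma isomorphic_torsion_Prufer : isomorphic TorG (zinv_mod (1 : Zinv p)) -> m = 1%N.
Proof.
move=> [f [g fK gK]]; have fM : {morph f : x y / (x * y)%g} by exact: gmulfM.
have multX (a : Zinv p) n : ((a : Algebra.to_multiplicative (Zinv p)) ^+ n)%g = a *+ n.
  by elim: n => // n IHn; rewrite expgS IHn mulrS.
have tX n : (torsion_map (1%R : Zinv p) ^+ n)%g = torsion_map (n%:R : Zinv p).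
  by rewrite -(morph_X torsion_mapM) multX.
have [j fj] : exists j, (f (torsion_map (1%R : Zinv p)) ^+ (p ^ j) = 1)%g.
  have [a <-] := zinv_mod_map_surj (f (torsion_map (1%R : Zinv p))).
  have /asboolP[n [j aE]] := valP (a : Zinv p); exists j.
  have aX k : (zinv_mod_map 1%R a ^+ k)%g = zinv_mod_map 1 ((a : Zinv p) *+ k).
    by rewrite -(morph_X (@zinv_mod_mapM _ _)) multX.
  rewrite aX; apply/zinv_mod_map_ker/asboolP; exists n; apply: val_inj.
  rewrite val_Mn val_Mz rmorph1 aE -[LHS]mulr_natr natrX mulfVK ?expf_neq0 //.
have : torsion_map ((p ^ j)%:R : Zinv p) = 1%g.
  by rewrite -tX -[LHS]fK (morph_X fM) fj -(morph_1 fM) fK.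
move/torsion_map_ker/asboolP=> [k /(congr1 val)].
rewrite val_Mz !rmorph_nat => E.
have {E} : ((p ^ j)%:Z)%:~R = (m%:Z * k)%:~R :> rat.
  by rewrite -pmulrn E rmorphM /= -pmulrn mulrzr.
move/intr_inj/(congr1 absz); rewrite abszM /= => E.
have : (m %| p ^ j)%N by rewrite E dvdn_mulr.
have /coprime_dvdl : (m %| m)%N by []. move=> _ /gcdn_idPl mE.
have : coprime m (p ^ j) by rewrite coprimeXr // coprime_sym.
by rewrite /coprime mE => /eqP.
Qed.

End CyclicKernel.
End CyclicQuotient.

Lemma isomorphic_center p (p_pr : prime p) :
  isomorphic (subgrp (center_group (abels p_pr))) (Algebra.to_multiplicative (Zinv p)).
Proof.
pose f (a : Algebra.to_multiplicative (Zinv p)) : subgrp (center_group (abels p_pr)) :=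
  Sub (E03 p_pr (a : Zinv p)) (E03_center p_pr (a : Zinv p)).
have fE a : val (f a) = E03 p_pr (a : Zinv p) by exact: SubK.
apply: (@isomorphic_of_kernels (Algebra.to_multiplicative (Zinv p)) _ _ f id) => // [a b|x|b|a].
- by apply: val_inj; rewrite fE E03D.
- have [a xE] := centerE (valP x); exists (a : Algebra.to_multiplicative (Zinv p)).
  by apply: val_inj; rewrite fE xE.
- by exists b.
- have E1 : val (1%g : subgrp (center_group (abels p_pr))) = 1%g by [].
  split=> [/(congr1 val)|->]; last by apply: val_inj; rewrite fE E1 [LHS]E03_0.
  by rewrite fE E1 -(E03_0 p_pr) => /E03_inj.
Qed.

Section Quotients.
Variables (p : nat) (p_pr : prime p).
Local Notation H := (abels p_pr).
Variables (C : {pred abels p_pr}) (gC : group_closed C).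
Hypothesis sCZ : {subset C <= center (abels p_pr)}.
Local Notation G := (quotg (sub_center_normal gC sCZ)).
Local Notation q := (quotg_map (sub_center_normal gC sCZ)).

Lemma finitely_presented_quotient r : cyclic_on C r -> finitely_presented G.
Proof.
move=> Cr; have [w wE] := abels_gens_generate (E03 p_pr r).
exists 7%N, (w :: abels_relators p); apply: isomorphic_presents.
have -> : (fun u : word 7 => is_true (u \in w :: abels_relators p)) =
    (fun u => u \in abels_relators p \/ u = w).
  apply/funext=> u; apply/propext; rewrite in_cons.
  by split=> [/orP[/eqP|]|[->|->]]; rewrite ?eqxx ?orbT; auto.
apply: (presents_quotient (S := fun u => u = w) (abels_presentation p_pr) (@quotg_mapM _ _ _)).
- exact: quotg_map_surj.
- by move=> _ ->; rewrite wE; apply/quotg_map_ker/Cr; exists 1; rewrite mulr1z.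
- move=> T gT /(_ w erefl); rewrite wE => Tr A /quotg_map_ker/Cr[k ->].
  exact: mem_E03_mulz.
Qed.

Section TorsionQuotient.
Hypothesis torG : torsion G =i quotg_image (sub_center_normal gC sCZ) (center H).
Local Notation GT := (quotg (torsion_normal G)).

Let f : H -> GT := quotg_map (torsion_normal G) \o q.

Let fM : {morph f : A B / (A * B)%g}.
Proof. by move=> A B; rewrite /f /= !quotg_mapM. Qed.

Let f_surj a : exists A, f A = a.
Proof.
have [x <-] := quotg_map_surj a; have [A <-] := quotg_map_surj x.
by exists A.
Qed.

Let f_ker A : f A = 1%g <-> A \in center H.
Proof.
rewrite /f /= quotg_map_ker torG; apply: mem_quotg_image => //.
exact: center_group.
Qed.

Lemma isomorphic_central_quotient : isomorphic GT (quotg (center_normal H)).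
Proof.
apply: (isomorphic_of_kernels fM (@quotg_mapM _ _ _) f_surj).
  exact: quotg_map_surj.
by move=> A; rewrite f_ker quotg_map_ker.
Qed.

Lemma soluble_central_quotient : soluble GT.
Proof. exact: soluble_image fM f_surj (soluble_abels p_pr). Qed.

Lemma recursively_presented_central_quotient : recursively_presented GT.
Proof.
exists 7%N, (fun w => w \in abels_relators p \/ exists k, corner_word k = w); split.
  exact/rec_enumerable_family/rec_family_corner.
apply: isomorphic_presents.
apply: (presents_quotient (abels_presentation p_pr) fM f_surj) => [_ [k <-]|T gT Tk A].
  by rewrite eval_corner_word; apply/f_ker/E03_center.
move/f_ker; apply: center_sub => // k; rewrite -eval_corner_word.
by apply: Tk; exists k.
Qed.

Lemma central_quotient_not_fp : ~ finitely_presented GT.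
Proof.
move=> fp; have [A /f_ker//|s sZ sT] :=
  central_kernel_fg (@abels_gens_generate _ p_pr) fM f_surj _ fp.
have [z /sZ/f_ker//|T gT [sT' [z /f_ker Zz /negP nTz]]] := @center_not_fg _ p_pr s.
by apply: nTz; apply: sT Zz.
Qed.

End TorsionQuotient.
End Quotients.

(* Tor(G) = Z/C is isomorphic to Z[1/p]/mZ with m prime to p, and m may be    *)
(* taken equal to 1 exactly when C is generated by 1 + p^k E_{14}, k in Z.    *)
Theorem mainTheorem2 (p : nat) (p_pr : prime p) (C : {pred abels p_pr})
    (gC : group_closed C) (sCZ : {subset C <= center (abels p_pr)})
    (C_inf_cyclic : isomorphic (subgrp gC) (Algebra.to_multiplicative int)) :
  let H : groupType := abels p_pr in
  let nC := sub_center_normal gC sCZ in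
  let G : groupType := quotg nC in
  let TorG : groupType := subgrp (torsion_group G) in
  let GT : groupType := quotg (torsion_normal G) in
  [/\ isomorphic (subgrp (center_group H)) (Algebra.to_multiplicative (Zinv p)),
      finitely_presented G /\ soluble G,
      torsion G =i quotg_image nC (center H),
      (exists2 m : nat, coprime p m &
         isomorphic TorG (zinv_mod (m%:R : Zinv p))) /\
      (isomorphic TorG (zinv_mod (1 : Zinv p)) <->
       exists (c : H) (k : int),
         (val c : 'M[rat]_4) 0 3 = p%:R ^ k /\ C =i generated (pred1 c))
    & isomorphic GT (quotg (center_normal H)) /\
      [/\ soluble GT, recursively_presented GT & ~ finitely_presented GT]].
Proof.
move=> H nC G TorG GT.
have [r r0 Cr] := cyclic_onP sCZ C_inf_cyclic.
have [e [m [pm Cem]]] := cyclic_on_normal r0 Cr.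
have torG := torsion_quotient (gC := gC) (sCZ := sCZ) pm Cem.
split=> //.
- exact: isomorphic_center.
- split; first exact: finitely_presented_quotient Cr.
  apply: soluble_image (soluble_abels p_pr); first exact: (@quotg_mapM _ _ nC).
  exact: quotg_map_surj.
- split; first by exists m => //; apply: isomorphic_torsion pm Cem.
  split=> [/(isomorphic_torsion_Prufer pm Cem) m1 | [c [k [ck CE]]]].
    exists (E03 p_pr (pz p e)), e; split; first by rewrite -val_pz -(ent_E03 p_pr (pz p e)).
    by apply/cyclic_on_generated; move: Cem; rewrite m1 mulr1.
  have cC : c \in C by rewrite CE; apply: mem_generated; rewrite inE.
  have cE : c = E03 p_pr (pz p k).
    apply: center_ent03; [exact: (sCZ c cC) | exact: E03_center |].
    by rewrite ent_E03 val_pz -ck.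
  have Ck : cyclic_on C (pz p k * 1%:R).
    by rewrite mulr1; apply/cyclic_on_generated; rewrite -cE.
  exact: (isomorphic_torsion gC sCZ (coprimen1 p) Ck).
- split; first exact: isomorphic_central_quotient.
  split; first exact: soluble_central_quotient.
    exact: recursively_presented_central_quotient.
  exact: central_quotient_not_fp.
Qed.
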